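(* Let $X$ be a toric hyper-Kähler manifold and $s\in\mathfrak{s}^*_{\mathrm{reg}}$. For any $\lambda\in\mathbb{Z}^n$ there exist unique $A\in\mathrm{Alc}_s$ and $\beta\in\mathbb{X}_*(S)$ such that $\lambda=\mu_A+\beta$. Moreover, $\mathrm{LT}_s(\Theta_X(\lambda))=(-1)^{(\kappa,\beta)}\mathcal{E}(A)$.
   Context: Toric hyper-Kähler data. Fix $n\ge1$, $T=(\mathbb{C}^\times)^n$ and an exact sequence of algebraic tori $1\to S\to T\to H\to1$, $S\cong(\mathbb{C}^\times)^r$, $H\cong(\mathbb{C}^\times)^d$, $r+d=n$. $\mathbb{X}_*(\cdot)$, $\mathbb{X}^*(\cdot)$ are cocharacter and character lattices; $\varepsilon_i$ is the standard basis of $\mathbb{X}_*(T)=\mathbb{Z}^n$, $\varepsilon_i^*$ the dual basis of $\mathbb{X}^*(T)$. Let $\mathfrak{a}:\mathbb{X}_*(T)\to\mathbb{X}_*(H)$, $\mathfrak{b}:\mathbb{X}^*(T)\to\mathbb{X}^*(S)$ be the induced surjections, $\mathfrak{a}_i=\mathfrak{a}(\varepsilon_i)$, $\mathfrak{b}_i=\mathfrak{b}(\varepsilon_i^* )$; assume all $\mathfrak{a}_i\neq0$, $\mathfrak{b}_i\ne0$, and that any $d$ linearly independent $\mathfrak{a}_i$'s generate $\mathbb{X}_*(H)$ (unimodularity). $\mathbb{X}_*(S)=\mathrm{Ker}\,\mathfrak{a}$, $\mathbb{X}^*(H)=\mathrm{Ker}\,\mathfrak{b}$; $\mathfrak{h}^*_{\mathbb{R}}=\mathbb{X}^*(H)\otimes\mathbb{R}$,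 $\mathfrak{s}^*_{\mathbb{R}}=\mathbb{X}^*(S)\otimes\mathbb{R}$. A signed circuit is $C=C_+\sqcup C_-\subset\{1,\dots,n\}$ with $\{\mathfrak{a}_i\}_{i\in C}$ minimal linearly dependent and $\sum_{C_+}\mathfrak{a}_i=\sum_{C_-}\mathfrak{a}_i$; $\beta_C=\sum_{C_+}\varepsilon_i-\sum_{C_-}\varepsilon_i\in\mathbb{X}_*(S)$. Fix $\eta\in\mathbb{X}^*(S)$ with $\langle\eta,\beta_C\rangle\ne0$ for all $C$. With $T$ acting on $T^*\mathbb{C}^n\ni(x,y)$ by $(tx,t^{-1}y)$ and $\mu(x,y)=\sum x_iy_i\mathfrak{b}_i$, put $X=\mu^{-1}(0)^{\eta\text{-ss}}/S$, where $(x,y)$ is $\eta$-semistable iff some $f\in\mathbb{C}[x,y]$ of $S$-weight $-m\eta$, $m>0$ ($x_i,y_i$ having weights $-\mathfrak{b}_i,\mathfrak{b}_i$) is nonzero at it. $\mathbb{S}=\mathbb{C}^\times$ acts by $\sigma(x,y)=(\sigma^{-1}x,\sigma^{-1}y)$; $\mathbb{T}=H\times\mathbb{S}$. $\mathcal{L}(\lambda)$ is the $\mathbb{T}$-equivariant line bundle on $X$ induced from $\lambda\in\mathbb{X}^*(T)$ (trivial $\mathbb{S}$-action). Identify $\mathbb{X}^*(T)\cong\mathbb{Z}^n\cong\mathbb{X}_*(T)$ by the standard inner product $(-,-)$, so that $\mathbb{X}_*(S),\mathbb{X}^*(H)\subset\mathbb{Z}^n$; $\kappa=(1,\dots,1)$.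 Alcoves. $\mathfrak{s}^*_{\mathrm{reg}}=\{s\in\mathfrak{s}^*_{\mathbb{R}}:\langle s,\beta_C\rangle\notin\mathbb{Z}\ \forall C\}$. Fix a splitting $\iota$ of $\mathfrak{b}$ and write $\iota(s)=(s_1,\dots,s_n)$. $\mathrm{Alc}_s$ is the set of connected components of the complement in $\mathfrak{h}^*_{\mathbb{R}}$ of the hyperplanes $\{x:\langle x,\mathfrak{a}_i\rangle+s_i=m\}$, $1\le i\le n$, $m\in\mathbb{Z}$. For $A\in\mathrm{Alc}_s$, $\mu_A=\sum_i\lfloor\langle x,\mathfrak{a}_i\rangle+s_i\rfloor\varepsilon_i^*\in\mathbb{Z}^n$ (any $x\in A$) and $\mathcal{E}(A)=\mathcal{L}(\mu_A)$. Theta functions. $\Theta_X(\lambda)=(q;q)_\infty^{-r}\sum_{\beta\in\mathbb{X}_*(S)}(-1)^{(\kappa,\beta)}q^{\frac12(\beta,\beta+\kappa)+(\lambda,\beta)}\mathcal{L}(\lambda+\beta)z^\beta$, with $(q;q)_\infty=\prod_{m\ge1}(1-q^m)$. Specializing $z=q^{-s}$, i.e. $z^\beta\mapsto q^{-\langle s,\beta\rangle}$, gives a series in real powers of $q$ with coefficients in $K_{\mathbb{T}}(X)$; for $f=\sum_{t\in\mathbb{R}}f_tq^t$ put $\mathrm{LT}(f)=f_{t_0}$, $t_0=\min\{t:f_t\neq0\}$, and $\mathrm{LT}_s(\Theta_X(\lambda))=\mathrm{LT}(\Theta_X(\lambda)|_{z=q^{-s}})$. *)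

(* Defs.v *)
From HB Require Import structures.
From mathcomp Require Import all_boot all_order all_algebra.
From mathcomp Require Import ring_quotient.
From mathcomp Require Import all_classical all_reals all_analysis.
From mathcomp Require Import complex.
From mathcomp Require freeg mpoly.
Import -(notations) freeg mpoly.

Set Implicit Arguments.
Unset Strict Implicit.
Unset Printing Implicit Defensive.
Import Order.TTheory GRing.Theory Num.Theory.
Import numFieldNormedType.Exports.

Local Open Scope classical_set_scope.
Local Open Scope ring_scope.

(* The lattices X_*(H), X^*(T) = X_*(T), X^*(S) are the spaces of integral
   column vectors of sizes d, n, r, and dual lattices are paired by [dot].
   A homomorphism of tori is the same as a homomorphism of cocharacter
   lattices, so the exact sequence 1 -> S -> T -> H -> 1 is given by matrices
     a : X_*(T) -> X_*(H)   and   b : X^*(T) -> X^*(S).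
   The columns of a and b are the a_i and b_i; the transposes of a and b are
   the inclusions X^*(H) -> Z^n and X_*(S) -> Z^n. An element of X_*(S) is
   represented by u : 'cV_r, standing for b^T *m u in Z^n. *)

Definition dot {K : pzRingType} {m : nat} (u v : 'cV[K]_m) : K :=
  (u^T *m v) 0 0.

Definition intcV (K : pzRingType) (m : nat) (u : 'cV[int]_m) : 'cV[K]_m :=
  map_mx intr u.

Definition inclS {r n : nat} (b : 'M[int]_(r, n)) (u : 'cV[int]_r) :
  'cV[int]_n := b^T *m u.

Definition kappa {n : nat} : 'cV[int]_n := const_mx 1.

(* Linear independence over Z of vectors in a lattice is the same as linear
   independence over the rational, real or complex numbers. *)
Definition lin_indep {d n : nat} (a : 'M[int]_(d, n)) (I : {set 'I_n}) : Prop :=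
  forall c : 'I_n -> int,
    \sum_(i in I) c i *: col i a = 0 -> forall i, i \in I -> c i = 0.

Definition is_circuit {d n : nat} (a : 'M[int]_(d, n)) (Cp Cm : {set 'I_n}) :
  Prop :=
  [/\ [disjoint Cp & Cm]%B,
      ~ lin_indep a (Cp :|: Cm),
      forall J : {set 'I_n}, J \proper Cp :|: Cm -> lin_indep a J &
      \sum_(i in Cp) col i a = \sum_(i in Cm) col i a].

Definition circuit_vec {n : nat} (Cp Cm : {set 'I_n}) : 'cV[int]_n :=
  \col_i ((i \in Cp)%:R - (i \in Cm)%:R).

Definition unimodular {d n : nat} (a : 'M[int]_(d, n)) : Prop :=
  forall I : {set 'I_n}, #|I| = d -> lin_indep a I ->
  forall v : 'cV[int]_d, exists c : 'I_n -> int, v = \sum_(i in I) c i *: col i a.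

Record toric_hyperkahler_data (n r d : nat) (a : 'M[int]_(d, n))
    (b : 'M[int]_(r, n)) (eta : 'cV[int]_r) : Prop := ToricHyperkahlerData {
  thk_n_gt0 : (0 < n)%N;
  thk_dim : (r + d)%N = n;
  thk_a_surj : forall w : 'cV[int]_d, exists v : 'cV[int]_n, a *m v = w;
  thk_b_surj : forall w : 'cV[int]_r, exists v : 'cV[int]_n, b *m v = w;
  thk_exact : forall v : 'cV[int]_n, a *m v = 0 <-> exists u, v = inclS b u;
  thk_a_neq0 : forall i, col i a != 0;
  thk_b_neq0 : forall i, col i b != 0;
  thk_unimodular : unimodular a;
  thk_generic : forall Cp Cm, is_circuit a Cp Cm ->
    forall u, inclS b u = circuit_vec Cp Cm -> dot eta u != 0
}.

Section Zariski.
Variable R : realType.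
Local Notation C := R[i].

Definition peval {m : nat} (f : mpoly m C) (v : 'rV[C]_m) : C :=
  meval (fun i => v 0 i) f.

Definition zariski_open_in {m : nat} (V W : set 'rV[C]_m) : Prop :=
  exists F : set (mpoly m C),
    W = [set v | V v /\ exists2 f, F f & peval f v != 0].

(* Used when W is locally closed. *)
Definition regular_on {m : nat} (W : set 'rV[C]_m) (h : 'rV[C]_m -> C) : Prop :=
  forall w, W w -> exists f g : mpoly m C, peval g w != 0 /\
    forall v, W v -> peval g v != 0 -> h v = peval f v / peval g v.

Definition regular_mx_on {m k l : nat} (W : set 'rV[C]_m)
    (M : 'rV[C]_m -> 'M[C]_(k, l)) : Prop :=
  forall i j, regular_on W (fun v => M v i j).

Definition torus {m : nat} : set 'rV[C]_m := [set t | forall i, t 0 i != 0].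

Definition torus_mul {m : nat} (t t' : 'rV[C]_m) : 'rV[C]_m :=
  \row_i (t 0 i * t' 0 i).

(* T^*C^n is the space of row vectors (x, y). The group T x SS, where SS is
   the torus C^* acting by dilation, is the space of row vectors (t, sigma)
   with nonzero entries. *)

Section Variety.
Variables (n r : nat) (b : 'M[int]_(r, n)) (eta : 'cV[int]_r).

Local Notation pt := 'rV[C]_(n + n).
Local Notation grp := 'rV[C]_(n + 1).

Definition gact (g : grp) (p : pt) : pt :=
  let t := lsubmx g in let sigma := rsubmx g 0 0 in
  row_mx (\row_i (sigma^-1 * (t 0 i * lsubmx p 0 i)))
         (\row_i (sigma^-1 * ((t 0 i)^-1 * rsubmx p 0 i))).

(* The homomorphism S -> T, followed by T -> T x SS. *)
Definition embS (s : 'rV[C]_r) : grp :=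
  row_mx (\row_i \prod_j (s 0 j) ^ (b j i)) (const_mx 1).

Definition charT (lam : 'cV[int]_n) (g : grp) : C :=
  \prod_i (lsubmx g 0 i) ^ (lam i 0).

Definition moment_map (p : pt) : 'cV[C]_r :=
  \sum_i (lsubmx p 0 i * rsubmx p 0 i) *: intcV C (col i b).

(* The S-weight of a monomial, where x_i and y_i have weights -b_i and b_i. *)
Definition monomial_weight (m : multinom (n + n)) : 'cV[int]_r :=
  \sum_(i < n) ((m (rshift n i))%:Z - (m (lshift n i))%:Z) *: col i b.

Definition has_weight (f : mpoly (n + n) C) (w : 'cV[int]_r) : Prop :=
  forall m, m \in msupp f -> monomial_weight m = w.

Definition semistable : set pt :=
  [set p | exists m : nat, exists f : mpoly (n + n) C,
     [/\ (0 < m)%N, has_weight f (- (eta *+ m)) & peval f p != 0]].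

Definition Zss : set pt := [set p | moment_map p = 0 /\ semistable p].

Definition orbitS (p : pt) : set pt :=
  [set gact (embS s) p | s in torus].

(* The points of X are S-orbits; its open sets and regular functions are those
   whose pull-backs to Zss are open, resp. regular. For generic eta the group S
   acts freely on Zss and all its orbits in Zss are closed. *)
Local Notation Xpt := (set pt).

Definition X : set Xpt := [set orbitS p | p in Zss].

Definition over (U : set Xpt) : set pt := [set p | Zss p /\ U (orbitS p)].

Definition open_in_X (U : set Xpt) : Prop :=
  U `<=` X /\ zariski_open_in Zss (over U).

Definition regular_mx_on_X {k l : nat} (U : set Xpt) (M : Xpt -> 'M[C]_(k, l)) :
  Prop :=
  regular_mx_on (over U) (fun p => M (orbitS p)).

Definition Xact (g : grp) (x : Xpt) : Xpt := gact g @` x.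

(* Regularity on an open subset W of (T x SS) x X. *)
Definition regular_mx_on_GX {k l : nat} (W : set (grp * Xpt))
    (M : grp -> Xpt -> 'M[C]_(k, l)) : Prop :=
  regular_mx_on
    [set w : 'rV[C]_((n + 1) + (n + n)) |
       [/\ torus (lsubmx w), Zss (rsubmx w) &
           W (lsubmx w, orbitS (rsubmx w))]]
    (fun w => M (lsubmx w) (orbitS (rsubmx w))).

(* Since H = T / S, an action of H x SS is an action of T x SS for which S
   acts trivially. *)

(* Total spaces of bundles are subsets of this type. The total space of a
   vector bundle on X has at most the cardinality of C, hence can be transported
   into it; fixing the type keeps the collection of all bundles small. *)
Definition ambient : Type := set (pt * C).

(* A local trivialisation over chart_dom; chart_map e is the fibre coordinate
   of e, and is meaningful only if e lies over chart_dom. *)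
Record chart := Chart {
  chart_rk : nat;
  chart_dom : set Xpt;
  chart_map : ambient -> 'rV[C]_chart_rk
}.

Record bundle_data := BundleData {
  bdl_tot : set ambient;
  bdl_proj : ambient -> Xpt;
  bdl_atlas : set chart;
  bdl_act : grp -> ambient -> ambient
}.

(* The vector space structure of the fibres is the one transported by the
   charts: transition functions and the action are linear in the charts. *)
Record is_vbundle (E : bundle_data) : Prop := IsVbundle {
  vb_proj : forall e, bdl_tot E e -> X (bdl_proj E e);
  vb_dom : forall c, bdl_atlas E c -> open_in_X (chart_dom c);
  vb_cover : forall x, X x -> exists2 c, bdl_atlas E c & chart_dom c x;
  vb_triv : forall c, bdl_atlas E c -> forall x, chart_dom c x ->
    forall v, exists! e, [/\ bdl_tot E e, bdl_proj E e = x & chart_map c e = v];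
  vb_transition : forall c c', bdl_atlas E c -> bdl_atlas E c' ->
    exists2 M : Xpt -> 'M[C]_(chart_rk c, chart_rk c'),
      regular_mx_on_X (chart_dom c `&` chart_dom c') M &
      forall e, bdl_tot E e ->
        chart_dom c (bdl_proj E e) -> chart_dom c' (bdl_proj E e) ->
        chart_map c' e = chart_map c e *m M (bdl_proj E e);
  vb_act_tot : forall g e, torus g -> bdl_tot E e -> bdl_tot E (bdl_act E g e);
  vb_act_proj : forall g e, torus g -> bdl_tot E e ->
    bdl_proj E (bdl_act E g e) = Xact g (bdl_proj E e);
  vb_act1 : forall e, bdl_tot E e -> bdl_act E (const_mx 1) e = e;
  vb_actM : forall g g' e, torus g -> torus g' -> bdl_tot E e ->
    bdl_act E (torus_mul g g') e = bdl_act E g (bdl_act E g' e);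
  vb_act_S : forall s e, torus s -> bdl_tot E e -> bdl_act E (embS s) e = e;
  vb_act_regular : forall c c', bdl_atlas E c -> bdl_atlas E c' ->
    exists2 M : grp -> Xpt -> 'M[C]_(chart_rk c, chart_rk c'),
      regular_mx_on_GX
        [set gx | chart_dom c gx.2 /\ chart_dom c' (Xact gx.1 gx.2)] M &
      forall g e, torus g -> bdl_tot E e ->
        chart_dom c (bdl_proj E e) -> chart_dom c' (Xact g (bdl_proj E e)) ->
        chart_map c' (bdl_act E g e) = chart_map c e *m M g (bdl_proj E e)
}.

Record is_morphism (E F : bundle_data) (f : ambient -> ambient) :
  Prop := IsMorphism {
  mor_tot : forall e, bdl_tot E e -> bdl_tot F (f e);
  mor_proj : forall e, bdl_tot E e -> bdl_proj F (f e) = bdl_proj E e;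
  mor_act : forall g e, torus g -> bdl_tot E e ->
    f (bdl_act E g e) = bdl_act F g (f e);
  mor_regular : forall c c', bdl_atlas E c -> bdl_atlas F c' ->
    exists2 M : Xpt -> 'M[C]_(chart_rk c, chart_rk c'),
      regular_mx_on_X (chart_dom c `&` chart_dom c') M &
      forall e, bdl_tot E e ->
        chart_dom c (bdl_proj E e) -> chart_dom c' (bdl_proj E e) ->
        chart_map c' (f e) = chart_map c e *m M (bdl_proj E e)
}.

Definition fibre_zero (E : bundle_data) (e : ambient) : Prop :=
  exists c, [/\ bdl_atlas E c, chart_dom c (bdl_proj E e) & chart_map c e = 0].

Definition short_exact (E1 E2 E3 : bundle_data) : Prop :=
  exists f g : ambient -> ambient,
  [/\ is_morphism E1 E2 f /\ is_morphism E2 E3 g,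
      forall e e', bdl_tot E1 e -> bdl_tot E1 e' -> f e = f e' -> e = e',
      forall e, bdl_tot E3 e -> exists2 e', bdl_tot E2 e' & g e' = e &
      forall e, bdl_tot E2 e ->
        (fibre_zero E3 (g e) <-> exists2 e', bdl_tot E1 e' & f e' = e)].

(* KX is the Grothendieck group of equivariant vector bundles on X. As X is
   smooth and quasi-projective, it is also the Grothendieck group of
   equivariant coherent sheaves. *)

Definition vbundle := {E : bundle_data | is_vbundle E}.
HB.instance Definition _ := gen_eqMixin vbundle.
HB.instance Definition _ := gen_choiceMixin vbundle.

Definition free_vb := FreegDefs.type_of (Phant int) (Phant vbundle).
HB.instance Definition _ := GRing.Zmodule.on free_vb.

Definition gen_vb (E : vbundle) : free_vb := Freeg [:: (1 : int, E)].

Definition exact_relations : set free_vb :=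
  [set z | exists E1 E2 E3 : vbundle,
     short_exact (sval E1) (sval E2) (sval E3) /\
     z = gen_vb E2 - gen_vb E1 - gen_vb E3].

(* The subgroup generated by the exact sequences. *)
Definition relations : {pred free_vb} := fun z =>
  `[< forall N : set free_vb, N 0 -> (forall x y, N x -> N y -> N (x - y)) ->
      exact_relations `<=` N -> N z >].

Lemma relations_closed : zmod_closed relations.
Proof.
split=> [|x y /asboolP Nx /asboolP Ny]; apply/asboolP => N N0 NB Nrel.
  exact: N0.
apply: (NB); [exact: (Nx N N0 NB Nrel)|exact: (Ny N N0 NB Nrel)].
Qed.
HB.instance Definition _ := GRing.isZmodClosed.Build free_vb relations
  relations_closed.

Definition KX := Quotient.quot relations.
HB.instance Definition _ := GRing.Zmodule.on KX.

(* The class is 0 by convention if the data do not form a vector bundle. That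
   the data Lbundle below do so depends on unimodularity and genericity. *)
Definition Kclass (E : bundle_data) : KX :=
  match pselect (is_vbundle E) with
  | left vbE => \pi_KX (gen_vb (exist _ E vbE))
  | right _ => 0
  end%qT.

(* L(lambda) is the quotient of Zss x C by S. The action of T x SS is induced by
   (t, sigma)(p, v) = ((t, sigma) p, t^lambda v). *)

Definition Lact (lam : 'cV[int]_n) (g : grp) (pv : pt * C) : pt * C :=
  (gact g pv.1, charT lam g * pv.2).

Definition Lorbit (lam : 'cV[int]_n) (pv : pt * C) : ambient :=
  [set Lact lam (embS s) pv | s in torus].

(* The charts over U are induced by the maps (p, v) |-> v h(p), for h a nowhere
   vanishing regular function on the inverse image of U in Zss. *)
Definition Lchart (lam : 'cV[int]_n) : set chart :=
  [set c | exists (U : set Xpt) (phi : ambient -> 'rV[C]_1) (h : pt -> C),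
     [/\ c = Chart U phi, open_in_X U, regular_on (over U) h,
         forall p, over U p -> h p != 0 &
         forall p v, over U p -> phi (Lorbit lam (p, v)) = const_mx (v * h p)]].

Definition Lbundle (lam : 'cV[int]_n) : bundle_data := {|
  bdl_tot := [set e | exists2 pv, Zss pv.1 & e = Lorbit lam pv];
  bdl_proj := fun e => fst @` e;
  bdl_atlas := Lchart lam;
  bdl_act := fun g e => Lact lam g @` e
|}.

Definition Lclass (lam : 'cV[int]_n) : KX := Kclass (Lbundle lam).

End Variety.
End Zariski.

Section Alcoves.
Variables (R : realType) (n r d : nat).
Variables (a : 'M[int]_(d, n)) (b : 'M[int]_(r, n)).
(* s is a point of s^*_R = R^r, iota a splitting of b, A a subset of
   h^*_R = R^d. *)
Variables (iota : 'M[int]_(n, r)) (s : 'cV[R]_r).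

Definition s_regular : Prop :=
  forall Cp Cm, is_circuit a Cp Cm ->
  forall u, inclS b u = circuit_vec Cp Cm ->
  forall m : int, dot s (intcV R u) <> m%:~R.

Definition height (x : 'cV[R]_d) (i : 'I_n) : R :=
  dot x (intcV R (col i a)) + (map_mx intr iota *m s) i 0.

Definition arrangement_complement : set 'cV[R]_d :=
  [set x | forall (i : 'I_n) (m : int), height x i <> m%:~R].

Definition Alc : set (set 'cV[R]_d) :=
  [set connected_component arrangement_complement x |
     x in arrangement_complement].

(* The floors do not depend on the point of A that is picked. *)
Definition mu (A : set 'cV[R]_d) : 'cV[int]_n :=
  \col_i Num.floor (height (xget 0 A) i).

End Alcoves.

(* prod_{1 <= m <= N} (1 - q^m), which agrees with (q; q)_oo up to q^N *)
Definition qpochhammer_trunc (N : nat) : {poly int} :=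
  \prod_(1 <= m < N.+1) (1 - 'X^m).

(* The coefficient of q^k in (q; q)_oo^(-r), computed with the geometric series
   1 / (1 - g) = sum_j g^j for g = 1 - (q; q)_oo^r, which is divisible by q. *)
Definition qpochhammer_inv_coef (r k : nat) : int :=
  (\sum_(j < k.+1) (1 - qpochhammer_trunc k ^+ r) ^+ j)`_k.

Section Theta.
Variables (R : realType) (n r : nat) (b : 'M[int]_(r, n)) (eta : 'cV[int]_r).

(* The exponent of q in the term of the specialised sum indexed by beta. *)
Definition theta_exponent (s : 'cV[R]_r) (lam : 'cV[int]_n) (u : 'cV[int]_r) :
  R :=
  let beta := inclS b u in
  (dot beta (beta + kappa))%:~R / 2 + (dot lam beta)%:~R - dot s (intcV R u).

(* A series in real powers of q is given by its coefficients. The coefficient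
   of q^t in Theta_X(lam) at z = q^(-s) is a sum over the pairs (k, beta) with
   k + theta_exponent s lam beta = t, of which there are finitely many. *)
Definition theta_coef (s : 'cV[R]_r) (lam : 'cV[int]_n) (t : R) :
  KX R b eta :=
  \sum_(ku \in [set ku : nat * 'cV[int]_r |
                  ku.1%:R + theta_exponent s lam ku.2 = t])
    (Lclass R b eta (lam + inclS b ku.2)
       *~ (qpochhammer_inv_coef r ku.1 * (-1) ^ dot kappa (inclS b ku.2))).

End Theta.

(* The series sum_t f_t q^t has a leading term, equal to c. *)
Definition has_leading_term {R : realType} {K : zmodType} (f : R -> K) (c : K) :
  Prop :=
  exists t0 : R, [/\ f t0 <> 0, forall t, t < t0 -> f t = 0 & f t0 = c].

(* Main.v *)
Require Import Defs.
From HB Require Import structures.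
From mathcomp Require Import all_boot all_order all_algebra.
From mathcomp Require Import ring_quotient.
From mathcomp Require Import all_classical all_reals all_analysis.
From mathcomp Require Import complex.
From mathcomp Require freeg mpoly.
From mathcomp Require Import ring lra zify.
Import Order.TTheory GRing.Theory Num.Theory.
Local Open Scope ring_scope.
Set Implicit Arguments.
Unset Strict Implicit.
Unset Printing Implicit Defensive.

(** Completing the square, the exponent of the term of Theta_X(lambda) indexed
    by beta is, up to a constant, half the squared distance between the lattice
    point lambda + beta and the point iota(s) - kappa/2. The leading term is
    therefore carried by the points of lambda + X_*(S) closest to
    iota(s) - kappa/2, and the theorem amounts to three facts.

    Closest points are the floor vectors of alcoves. A point v = lambda + beta
    equals mu_A for some alcove A exactly when the affine space iota(s) + h^*
    meets the open cube v + (0,1)^n, that is, when the displacement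
    w = iota(s) - v - kappa/2 can be moved into (-1/2,1/2)^n along the
    orthogonal h^* of X_*(S). If it can, then for every gamma <> 0 in X_*(S)
    the pairing (w,gamma) is smaller than |gamma|_1 / 2 <= |gamma|^2 / 2, so v
    is the unique closest point ([theta_exponent_strict_min]). If it cannot, a
    Farkas certificate ([cube_or_excess]) provides a real vector gamma in
    Ker(a) with (w,gamma) >= |gamma|_1 / 2. Cancelling coordinates of gamma
    along circuits reduces its support until gamma is itself a circuit vector
    beta_C ([circuit_excess]); since beta_C has entries 0 and +-1, minimality
    forces (w,beta_C) = |beta_C|^2 / 2, which makes <s,beta_C> an integer and
    contradicts the regularity of s ([theta_min_cube]). Thus the Voronoi cell
    of X_*(S) is the projection of the unit cube, and for regular s there is
    exactly one closest point.

    Alcoves are determined by their floor vectors, because the points with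
    given floors form a convex, hence connected, set ([mu_inj]).

    The leading coefficient does not vanish. The class of L(nu) must be shown
    to be non-zero in K-theory. At a semistable point genericity of eta makes
    the a_i with x_i = y_i = 0 linearly independent ([vanishing_indep]), so by
    unimodularity every character of S is the weight of a Laurent monomial in
    the non-vanishing coordinates ([supported_weight]). These monomials
    trivialise L(nu) locally ([Lbundle_is_vbundle]). The rank at a point of X
    is additive on exact sequences, hence is a homomorphism from K-theory to
    the integers, and it sends L(nu) to 1 ([Lclass_neq0]). *)

(** * Pairings of lattice vectors *)

Lemma dotE (K : pzRingType) (m : nat) (u v : 'cV[K]_m) :
  dot u v = \sum_i u i 0 * v i 0.
Proof. by rewrite /dot mxE; apply: eq_bigr => i _; rewrite mxE. Qed.

Lemma dotC (K : comPzRingType) (m : nat) (u v : 'cV[K]_m) : dot u v = dot v u.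
Proof. by rewrite !dotE; apply: eq_bigr => i _; rewrite mulrC. Qed.

Lemma dotDl (K : pzRingType) (m : nat) (u v w : 'cV[K]_m) :
  dot (u + v) w = dot u w + dot v w.
Proof. by rewrite /dot linearD mulmxDl mxE. Qed.

Lemma dot_suml (K : pzRingType) (m : nat) (I : finType) (P : pred I) (F : I -> 'cV[K]_m)
    (v : 'cV[K]_m) : dot (\sum_(i | P i) F i) v = \sum_(i | P i) dot (F i) v.
Proof. by rewrite /dot linear_sum mulmx_suml summxE. Qed.

Lemma dot_scalel (K : comPzRingType) (m : nat) (c : K) (u v : 'cV[K]_m) :
  dot (c *: u) v = c * dot u v.
Proof. by rewrite /dot linearZ -scalemxAl mxE. Qed.

Lemma intcVE (K : pzRingType) (m : nat) (u : 'cV[int]_m) i j :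
  intcV K u i j = (u i j)%:~R.
Proof. by rewrite mxE. Qed.

Lemma dot_intcV (K : pzRingType) (m : nat) (u v : 'cV[int]_m) :
  dot (intcV K u) (intcV K v) = (dot u v)%:~R.
Proof.
rewrite /dot !mxE rmorph_sum; apply: eq_bigr => i _.
by rewrite !mxE rmorphM.
Qed.

(** * Unimodular systems of vectors *)

(** Clearing denominators: multiply the relation by the product of the
    denominators of all coefficients. *)
Lemma lin_indep_rat (d n : nat) (a : 'M[int]_(d, n)) (I : {set 'I_n}) :
  lin_indep a I -> forall c : 'I_n -> rat,
  \sum_(i in I) c i *: map_mx intr (col i a) = 0 -> forall i, i \in I -> c i = 0.
Proof.
move=> indI c c0.
pose N := \prod_(j : 'I_n) denq (c j).
have N_neq0 : N != 0 by apply/prodf_neq0 => j _; exact: denq_neq0.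
pose m i := numq (c i) * \prod_(j | j != i) denq (c j).
have mE i : (m i)%:~R = N%:~R * c i :> rat.
  rewrite /m /N [X in X%:~R * _](bigD1 i) //= !rmorphM /= mulrAC.
  by rewrite [_ * c i]mulrC -numqE.
have m0 : \sum_(i in I) m i *: col i a = 0.
  apply/matrixP => k l; move/matrixP: c0 => /(_ k l).
  rewrite !summxE !mxE => c0; apply: (@intr_inj rat).
  rewrite rmorph_sum /=.
  transitivity (N%:~R * \sum_(i in I) (c i *: map_mx intr (col i a) : 'M[rat]__) k l);
    last by rewrite c0 mulr0.
  rewrite mulr_sumr; apply: eq_bigr => i _.
  by rewrite !mxE rmorphM /= mE mulrA.
move=> i iI; have := indI _ m0 i iI => /eqP.
rewrite -(intr_eq0 rat) mE mulf_eq0 intr_eq0 (negPf N_neq0) /=.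
by move/eqP.
Qed.

Section Unimodular.
Variables (d n : nat) (a : 'M[int]_(d, n)).
Hypothesis a_surj : forall w : 'cV[int]_d, exists v : 'cV[int]_n, a *m v = w.
Hypothesis a_unimod : unimodular a.

(** Over the rationals, the rows indexed by a maximal independent set are free
    and span, since the a_i together span. *)
Lemma card_max_lin_indep (K : {set 'I_n}) :
  lin_indep a K -> (forall i, i \notin K -> ~ lin_indep a (i |: K)) -> #|K| = d.
Proof.
move=> indK maxK.
pose B : 'M[rat]_(#|K|, d) := \matrix_(k, l) (a l (enum_val k))%:~R.
have rowB k : row k B = (map_mx intr (col (enum_val k) a))^T.
  by apply/rowP => l; rewrite !mxE.
have freeB : row_free B.
  apply: inj_row_free => v vB; apply/rowP => k; rewrite [RHS]mxE.
  pose c i := v 0 (enum_rank_in (enum_valP k) i).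
  have := lin_indep_rat indK (c := c) _ (enum_valP k).
  rewrite /c enum_valK_in; apply.
  transitivity (v *m B)^T; last by rewrite vB trmx0.
  rewrite big_enum_val mulmx_sum_row linear_sum /=.
  apply: eq_bigr => j _.
  by rewrite enum_valK_in rowB linearZ /= trmxK.
have colB i : ((map_mx intr (col i a))^T <= B)%MS.
  case: (boolP (i \in K)) => iK.
    have -> : (map_mx intr (col i a))^T = row (enum_rank_in iK i) B.
      by rewrite rowB enum_rankK_in.
    exact: row_sub.
  move: (maxK i iK) => /existsNP[c] /not_implyP[c0] /existsNP[j] /not_implyP[jiK cj].
  move: c0; rewrite big_setU1 //= => c0.
  have ci : c i != 0.
    apply/eqP => ci; move: c0; rewrite ci scale0r add0r => /indK c0.
    by move: jiK; rewrite in_setU1 => /orP[/eqP ji|/c0//]; apply: cj; rewrite ji.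
  have -> : (map_mx intr (col i a))^T =
     - (c i)%:~R^-1 *: \sum_(k in K) (c k)%:~R *: (map_mx intr (col k a))^T :> 'rV[rat]_d.
    apply: (scalerI (_ : (c i)%:~R != 0 :> rat)); first by rewrite intr_eq0.
    rewrite scalerA mulrN mulfV ?intr_eq0// scaleN1r; apply/eqP; rewrite -addr_eq0.
    apply/eqP/rowP => l; move/colP: c0 => /(_ l); rewrite !mxE !summxE.
    move=> c0l; transitivity ((0 : int)%:~R : rat); last by [].
    rewrite -c0l rmorphD /= rmorphM rmorph_sum /=.
    congr (_ + _); apply: eq_bigr => k _; rewrite !mxE /=.
    by rewrite rmorphM.
  apply: scalemx_sub; apply: summx_sub => k kK; apply: scalemx_sub.
  have -> : (map_mx intr (col k a))^T = row (enum_rank_in kK k) B.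
    by rewrite rowB enum_rankK_in.
  exact: row_sub.
have fullB : row_full B.
  rewrite -sub1mx; apply/row_subP => l.
  have [v av] := a_surj (delta_mx l 0).
  have -> : row l 1%:M = \sum_i (v i 0)%:~R *: (map_mx intr (col i a))^T :> 'rV[rat]_d.
    apply/rowP => m; move/colP: av => /(_ m); rewrite !mxE summxE.
    move=> avm; transitivity ((((m == l) && (0 == 0 :> 'I_1))%:R : int)%:~R : rat).
      by rewrite eqxx andbT eq_sym rmorph_nat.
    rewrite -avm rmorph_sum; apply: eq_bigr => i _.
    by rewrite !mxE rmorphM mulrC.
  by apply: summx_sub => i _; exact: scalemx_sub.
by move: freeB fullB; rewrite /row_free /row_full => /eqP-> /eqP.
Qed.

(** Extending to a maximal independent set gives a rational basis, which by
    unimodularity generates the lattice; the dual basis is then integral. All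
    further consequences of unimodularity are drawn from this dual basis. *)
Lemma basis_ext (I : {set 'I_n}) : lin_indep a I ->
  exists2 K : {set 'I_n}, I \subset K &
  exists x : 'I_n -> 'cV[int]_d,
    forall j k, j \in K -> k \in K -> dot (col j a) (x k) = (j == k)%:R.
Proof.
move=> indI.
have /maxset_exists[K /maxsetP[/asboolP indK maxK] sIK] :
  [pred J : {set 'I_n} | `[< lin_indep a J >]] I by apply/asboolP.
have cardK : #|K| = d.
  apply: card_max_lin_indep => // i iK indiK.
  have := maxK (i |: K); rewrite finset.subsetUr => /(_ _ isT) E.
  by move: iK; rewrite -E ?finset.setU11//; apply/asboolP.
exists K => //.
have gen l := a_unimod cardK indK (delta_mx l 0).
have [c cE] := choice gen.
pose x k : 'cV[int]_d := \col_l c l k.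
have rep v : v = \sum_(k in K) dot v (x k) *: col k a.
  apply/colP => m; rewrite summxE.
  transitivity (\sum_l v l 0 * (delta_mx l 0 : 'cV[int]_d) m 0).
    rewrite (bigD1 m) //= mxE !eqxx mulr1 big1 ?addr0// => l /negPf lm.
    by rewrite mxE eq_sym lm mulr0.
  under eq_bigr do rewrite cE summxE mulr_sumr.
  rewrite exchange_big /=; apply: eq_bigr => k _.
  rewrite /dot !mxE mulr_suml; apply: eq_bigr => l _.
  by rewrite !mxE mulrA.
exists x => j k jK kK.
pose e i := dot (col j a) (x i) - (j == i)%:R.
suff : e k = 0 by move/eqP; rewrite subr_eq0 => /eqP.
apply: indK kK; rewrite /e.
under eq_bigr do rewrite scalerBl.
rewrite sumrB -rep (bigD1 j jK) /= eqxx scale1r big1 ?addr0 ?subrr//.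
by move=> i /andP[_ /negPf]; rewrite eq_sym => ->; rewrite scale0r.
Qed.

(** Pairing a relation with the integral dual basis isolates each of its
    coefficients, over any ring. *)
Lemma lin_indep_ring (F : comNzRingType) (I : {set 'I_n}) : lin_indep a I ->
  forall c : 'I_n -> F, \sum_(i in I) c i *: intcV F (col i a) = 0 ->
  forall i, i \in I -> c i = 0.
Proof.
move=> /basis_ext[K /fintype.subsetP sIK [x xE]] c c0 i iI.
have : dot (\sum_(i in I) c i *: intcV F (col i a)) (intcV F (x i)) = 0.
  by rewrite c0 /dot trmx0 mul0mx mxE.
rewrite dot_suml (bigD1 i) //= dot_scalel dot_intcV xE ?sIK// eqxx mulr1.
rewrite big1 ?addr0// => j /andP[jI /negPf ji].
by rewrite dot_scalel dot_intcV xE ?sIK// ji mulr0.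
Qed.

(** The combination of the dual basis vectors with coefficients lam solves the
    interpolation problem. *)
Lemma lin_indep_interp (J : {set 'I_n}) (lam : 'cV[int]_n) : lin_indep a J ->
  exists x : 'cV[int]_d, forall j, j \in J -> (a^T *m x) j 0 = lam j 0.
Proof.
move=> /basis_ext[K /fintype.subsetP sJK [x xE]].
exists (\sum_(k in K) lam k 0 *: x k) => j /sJK jK.
rewrite mulmx_sumr summxE (bigD1 j) //=.
have entryE k : (a^T *m (lam k 0 *: x k)) j 0 = lam k 0 * dot (col j a) (x k).
  rewrite -scalemxAr mxE /dot !mxE; congr (_ * _).
  by apply: eq_bigr => i _; rewrite !mxE.
rewrite entryE xE// eqxx mulr1 big1 ?addr0// => k /andP[kK /negPf].
by rewrite entryE xE// eq_sym => ->; rewrite mulr0.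
Qed.

(** In a minimal relation with coefficients c, removing an index i leaves an
    independent set, and pairing with its dual basis shows that c i divides all
    the other coefficients. By symmetry all coefficients have the same absolute
    value, and dividing by it leaves coefficients +-1. *)
Lemma exists_circuit (J : {set 'I_n}) : ~ lin_indep a J ->
  exists Cp Cm, is_circuit a Cp Cm /\ Cp :|: Cm \subset J.
Proof.
move=> depJ.
have /minset_exists[C /minsetP[/asboolP depC minC] sCJ] :
  [pred J : {set 'I_n} | `[< ~ lin_indep a J >]] J by apply/asboolP.
have indC (J' : {set 'I_n}) : J' \proper C -> lin_indep a J'.
  move=> pJ'; apply: contrapT => depJ'.
  have E := minC J' (asboolT depJ') (proper_sub pJ').
  by move: pJ'; rewrite E fintype.properxx.
move: (depC) => /existsNP[c] /not_implyP[c0] /existsNP[j0] /not_implyP[j0C /eqP cj0].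
have c_dvd i k : i \in C -> k \in C -> (c i %| c k)%Z.
  move=> iC; have [->//|ki kC] := eqVneq k i.
  have kCi : k \in C :\ i by rewrite !inE ki.
  have [K /fintype.subsetP sK [x xE]] := basis_ext (indC _ (properD1 iC)).
  have : dot (\sum_(i in C) c i *: col i a) (x k) = 0.
    by rewrite c0 /dot trmx0 mul0mx mxE.
  rewrite dot_suml (bigD1 i) //= (bigD1 k) ?kC//= !dot_scalel (xE k k) ?sK// eqxx mulr1.
  rewrite big1 ?addr0 => [|j /andP[/andP[jC ji] /negPf jk]]; last first.
    by rewrite dot_scalel xE ?sK ?jk ?mulr0 // !inE ji.
  move/eqP; rewrite addrC addr_eq0 => /eqP->.
  by rewrite dvdzE abszN abszM dvdn_mulr.
have c_abs i : i \in C -> `|c i| = `|c j0|.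
  move=> iC; rewrite -!abszE; congr Posz; apply/eqP.
  by rewrite eqn_dvd; apply/andP; split; rewrite -dvdzE c_dvd.
exists [set i in C | 0 < c i], [set i in C | c i < 0].
have CE : [set i in C | 0 < c i] :|: [set i in C | c i < 0] = C.
  apply/setP => i; rewrite !inE -andb_orr; case: (boolP (i \in C)) => //= iC.
  rewrite orbC -neq_lt -normr_eq0 c_abs ?normr_eq0//.
rewrite CE; split => //; split; rewrite ?CE//.
  rewrite -setI_eq0; apply/eqP/setP => i; rewrite !inE.
  by case: ltgtP; rewrite ?andbF.
suff E : `|c j0| *: \sum_(i in [set i in C | (0 < c i)%R]) col i a
     = `|c j0| *: \sum_(i in [set i in C | (c i < 0)%R]) col i a.
  have N0 : `|c j0| != 0 by rewrite normr_eq0.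
  by apply/colP => m; apply: (mulfI N0); move/colP: E => /(_ m); rewrite 2!mxE.
apply/eqP; rewrite -subr_eq0 !scaler_sumr -[X in _ == X]c0.
have split_sum (P : pred 'I_n) (G : 'I_n -> 'cV[int]_d) :
  \sum_(i in [set i in C | P i]) G i = \sum_(i in C) (if P i then G i else 0).
  by rewrite -big_mkcondr; apply: eq_bigl => i; rewrite inE.
rewrite !split_sum -sumrB; apply/eqP/eq_bigr => i iC.
rewrite -(c_abs i iC); case: (ltgtP (c i) 0) => ci.
- by rewrite ltr0_norm// scaleNr sub0r opprK.
- by rewrite gtr0_norm// subr0.
- by rewrite ci scale0r subrr.
Qed.
End Unimodular.

(** * A strict Farkas lemma *)

Section Farkas.
Variables (F : realFieldType) (d : nat).
Local Notation constraint := ('cV[F]_d * F)%type.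
Implicit Types (S : seq constraint) (c : constraint).

(** The pairs (v, t) for which dot v x < t follows from the constraints in S by
    adding them and scaling them by positive factors. *)
Inductive cone S : constraint -> Prop :=
| cone_mem c : c \in S -> cone S c
| cone_add c c' : cone S c -> cone S c' -> cone S (c.1 + c'.1, c.2 + c'.2)
| cone_scale t c : 0 < t -> cone S c -> cone S (t *: c.1, t * c.2).

Lemma cone_trans S S' : (forall c, c \in S' -> cone S c) ->
  forall c, cone S' c -> cone S c.
Proof.
move=> sub c; elim=> {c} [c /sub//|c c' _ Sc _ Sc'|t c t0 _ Sc].
- exact: cone_add.
- exact: cone_scale.
Qed.

Lemma seq_lower (s : seq F) : exists t, forall u, u \in s -> t < u.
Proof.
elim: s => [|u s [t tP]]; first by exists 0.
exists (Num.min t (u - 1)) => v; rewrite inE => /predU1P[->|/tP].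
  by rewrite gt_min; apply/orP; right; lra.
by rewrite gt_min => ->.
Qed.

Lemma seq_above (l : F) (us : seq F) : (forall u, u \in us -> l < u) ->
  exists2 t, l < t & forall u, u \in us -> t < u.
Proof.
elim: us => [_|u us IH lt_l]; first by exists (l + 1) => //; lra.
have [|t lt tu] := IH; first by move=> v vus; apply: lt_l; rewrite inE vus orbT.
have lu := lt_l u (mem_head _ _).
exists (Num.min t ((l + u) / 2)); first by rewrite lt_min lt; lra.
move=> v; rewrite inE => /predU1P[->|/tu].
  by rewrite gt_min; apply/orP; right; lra.
by rewrite gt_min => ->.
Qed.

Lemma seq_between (ls us : seq F) : (forall l u, l \in ls -> u \in us -> l < u) ->
  exists t, (forall l, l \in ls -> l < t) /\ (forall u, u \in us -> t < u).
Proof.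
elim: ls => [_|l ls IH lt_lu]; first by have [t] := seq_lower us; exists t.
have [|t [lt tu]] := IH; first by move=> l' u l'ls; apply: lt_lu; rewrite inE l'ls orbT.
case: (ltP l t) => [l_t|t_l].
  by exists t; split => // l'; rewrite inE => /predU1P[->//|/lt].
have [m lm mu] := seq_above (fun u uus => lt_lu l u (mem_head _ _) uus).
exists m; split => // l'; rewrite inE => /predU1P[->//|/lt l't].
exact: lt_trans l't (le_lt_trans t_l lm).
Qed.

Lemma dotD_delta (v x : 'cV[F]_d) (t : F) (k : 'I_d) :
  dot v (x + t *: delta_mx k 0) = dot v x + t * v k 0.
Proof.
rewrite /dot mulmxDr mxE -scalemxAr; congr (_ + _).
rewrite !mxE (bigD1 k) //= !mxE !eqxx mulr1 big1 ?addr0// => j /negPf jk.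
by rewrite !mxE jk mulr0.
Qed.

(** Fourier-Motzkin elimination of one coordinate at a time: the constraints
    with a positive coefficient bound that coordinate above, those with a
    negative coefficient bound it below, and a value in between exists as soon
    as the remaining coordinates satisfy all sums of a normalised upper and a
    normalised lower constraint. These sums stay in the cone of S. *)
Lemma farkas_strict S :
  (exists x, forall c, c \in S -> dot c.1 x < c.2) \/
  (exists2 c, cone S c & c.1 = 0 /\ c.2 <= 0).
Proof.
suff elim_coord k : (k <= d)%N -> forall S : seq constraint,
  (forall c, c \in S -> forall i : 'I_d, (k <= i)%N -> c.1 i 0 = 0) ->
  (exists x, forall c, c \in S -> dot c.1 x < c.2) \/
  (exists2 c, cone S c & c.1 = 0 /\ c.2 <= 0).
  by apply: (elim_coord d) => // c _ i; rewrite leqNgt ltn_ord.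
elim: k => [_|k IH kd] {}S S0.
  have c10 c : c \in S -> c.1 = 0 by move=> cS; apply/colP => i; rewrite mxE S0.
  case: (boolP (all (fun c => 0 < c.2) S)) => [/allP Spos|/allPn[c cS]].
    left; exists 0 => c cS; rewrite /dot mulmx0 mxE; exact: Spos.
  by rewrite -leNgt => c0; right; exists c; [exact: cone_mem|split; [exact: c10|]].
pose o := Ordinal kd.
pose coef (c : constraint) := c.1 o 0.
pose nrm (c : constraint) : constraint := (`|coef c|^-1 *: c.1, `|coef c|^-1 * c.2).
pose S1 := [seq ((nrm c).1 + (nrm c').1, (nrm c).2 + (nrm c').2) |
    c <- [seq c <- S | 0 < coef c], c' <- [seq c <- S | coef c < 0]].
pose S' := [seq c <- S | coef c == 0] ++ S1.
have S'cone c : c \in S' -> cone S c.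
  rewrite mem_cat mem_filter => /orP[/andP[_]|]; first exact: cone_mem.
  case/allpairsP => -[c1 c2] /= []; rewrite !mem_filter => /andP[c1p c1S] /andP[c2n c2S] ->.
  apply: (@cone_add S (nrm c1) (nrm c2)); apply: cone_scale; try exact: cone_mem.
    by rewrite invr_gt0 normr_gt0 gt_eqF.
  by rewrite invr_gt0 normr_gt0 lt_eqF.
case: (IH (ltnW kd) S') => [c cS' i ki|[x xP]|[c Sc c0]]; last 1 first.
- by right; exists c => //; exact: cone_trans S'cone _ Sc.
- move: cS'; rewrite mem_cat mem_filter => /orP[/andP[/eqP c0 cS]|].
    have [/S0-> //|ik] := ltnP k i.
    by have -> : i = o by apply: val_inj => /=; apply/eqP; rewrite eqn_leq ik.
  case/allpairsP => -[c1 c2] /= []; rewrite !mem_filter => /andP[c1p c1S] /andP[c2n c2S] ->.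
  rewrite !mxE; have [ki'|ik] := ltnP k i.
    by rewrite (S0 c1)// (S0 c2)// !mulr0 addr0.
  have -> : i = o by apply: val_inj => /=; apply/eqP; rewrite eqn_leq ik.
  rewrite -!/(coef _) gtr0_norm// ltr0_norm// invrN mulNr !mulVf ?subrr//.
    by rewrite lt_eqF.
  by rewrite gt_eqF.
- left.
  pose bnd c := (c.2 - dot c.1 x) / coef c.
  have [l u|t [lt tu]] := @seq_between [seq bnd c | c <- S & coef c < 0]
    [seq bnd c | c <- S & 0 < coef c].
    move=> /mapP[c]; rewrite mem_filter => /andP[cn cS] ->.
    move=> /mapP[c']; rewrite mem_filter => /andP[c'p c'S] ->.
    have : ((nrm c').1 + (nrm c).1, (nrm c').2 + (nrm c).2) \in S'.
      by rewrite mem_cat; apply/orP; right; apply/allpairsP; exists (c', c);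
        rewrite !mem_filter cn c'p.
    move=> /xP /=; rewrite gtr0_norm// ltr0_norm// dotDl !dot_scalel invrN /bnd.
    set A := dot _ _; set B := dot _ _; move=> ?; lra.
  exists (x + t *: delta_mx o 0) => c cS; rewrite dotD_delta -/(coef c).
  case: (ltgtP (coef c) 0) => cc.
  + have /lt : bnd c \in [seq bnd c | c <- S & coef c < 0].
      by apply: map_f; rewrite mem_filter cc.
    by rewrite /bnd ltr_ndivrMr// => ?; lra.
  + have /tu : bnd c \in [seq bnd c | c <- S & 0 < coef c].
      by apply: map_f; rewrite mem_filter cc.
    by rewrite /bnd ltr_pdivlMr// => ?; lra.
  + rewrite cc mulr0 addr0; apply: xP.
    by rewrite mem_cat mem_filter cc eqxx cS.
Qed.
End Farkas.

(** * Reduction of certificates to circuits *)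

Section Excess.
Variables (F : realFieldType) (d n : nat) (a : 'M[int]_(d, n)) (w : 'cV[F]_n).
Implicit Types g : 'cV[F]_n.

(** On vectors g of Ker a, the excess is unchanged when w is moved along the
    orthogonal of Ker a, and it is negative for non-zero g if w lies in the open
    cube of side 1 centred at 0. *)
Definition excess g := \sum_i (w i 0 * g i 0 - `|g i 0| / 2).

Definition combination g := \sum_i g i 0 *: intcV F (col i a).

Lemma excessD g h : excess g + excess h <= excess (g + h).
Proof.
rewrite /excess -big_split /=; apply: ler_sum => i _; rewrite mxE.
by have := ler_normD (g i 0) (h i 0); lra.
Qed.

Lemma excessZ t g : 0 <= t -> excess (t *: g) = t * excess g.
Proof.
move=> t0; rewrite /excess mulr_sumr; apply: eq_bigr => i _.
by rewrite mxE normrM (ger0_norm t0); lra.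
Qed.

Lemma excessN g : excess (- g) = - excess g - \sum_i `|g i 0|.
Proof.
rewrite /excess -!sumrN -big_split /=; apply: eq_bigr => i _.
by rewrite mxE normrN; lra.
Qed.

Lemma excess_delta i t : excess (t *: delta_mx i 0) = w i 0 * t - `|t| / 2.
Proof.
rewrite /excess (bigD1 i) //= !mxE !eqxx mulr1 big1 ?addr0// => j /negPf ji.
by rewrite !mxE ji !mulr0 normr0; lra.
Qed.

Lemma combination_delta i t : combination (t *: delta_mx i 0) = t *: intcV F (col i a).
Proof.
rewrite /combination (bigD1 i) //= !mxE !eqxx mulr1 big1 ?addr0// => j /negPf ji.
by rewrite !mxE ji mulr0 scale0r.
Qed.

Lemma combinationD g h : combination (g + h) = combination g + combination h.
Proof.
by rewrite /combination -big_split /=; apply: eq_bigr => i _; rewrite mxE scalerDl.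
Qed.

Lemma combinationZ t g : combination (t *: g) = t *: combination g.
Proof.
by rewrite /combination scaler_sumr; apply: eq_bigr => i _; rewrite mxE scalerA.
Qed.

Lemma sum_norm_gt0 g : g != 0 -> 0 < \sum_i `|g i 0|.
Proof.
move=> g0; rewrite lt_neqAle sumr_ge0 ?andbT// eq_sym; apply: contra g0.
rewrite psumr_eq0// => /allP g0; apply/eqP/colP => i; rewrite mxE.
by apply/eqP; rewrite -normr_eq0; apply: g0; rewrite mem_index_enum.
Qed.

(** The 2n inequalities saying that w, moved by x, lies in the cube are strict,
    so [farkas_strict] applies. The multipliers of the two inequalities at i
    are collected in their difference g i, which can only increase the
    excess. *)
Lemma cube_or_excess :
  (exists x : 'cV[F]_d, forall i, `|w i 0 + dot x (intcV F (col i a))| < 1 / 2) \/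
  (exists g, [/\ g != 0, combination g = 0 & 0 <= excess g]).
Proof.
pose S : seq ('cV[F]_d * F) :=
  [seq (intcV F (col i a), 1 / 2 - w i 0) | i <- enum 'I_n] ++
  [seq (- intcV F (col i a), 1 / 2 + w i 0) | i <- enum 'I_n].
case: (farkas_strict S) => [[x xP]|[c Sc [c1 c2]]]; [left; exists x => i|right].
  have /xP /= : (intcV F (col i a), 1 / 2 - w i 0) \in S.
    by rewrite mem_cat; apply/orP; left; apply: map_f; rewrite mem_enum.
  have /xP /= : (- intcV F (col i a), 1 / 2 + w i 0) \in S.
    rewrite mem_cat; apply/orP; right.
    by apply: (map_f (fun i => (- intcV F (col i a), 1 / 2 + w i 0))); rewrite mem_enum.
  rewrite -scaleN1r dot_scalel dotC => ? ?; rewrite ltr_norml; lra.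
(* The alternative 0 < c.2 accounts for multipliers that cancel in g: each
   cancellation leaves a positive contribution to the bound. *)
have [g [gE ge g0]] : exists g, [/\ combination g = c.1, - excess g <= c.2 &
    g != 0 \/ 0 < c.2].
  elim: {c1 c2} Sc => {c} [c|c c' _ [g [gE ge g0]] _ [g' [g'E g'e g'0]]|
    t c t0 _ [g [gE ge g0]]].
  - have delta_neq0 t i : t != 0 -> t *: (delta_mx i 0 : 'cV[F]_n) != 0.
      move=> t0; apply/eqP => /matrixP /(_ i 0); rewrite !mxE !eqxx mulr1.
      exact/eqP.
    rewrite mem_cat => /orP[] /mapP[i _ ->] /=.
      exists (1 *: delta_mx i 0); split.
      + by rewrite combination_delta scale1r.
      + by rewrite excess_delta normr1; lra.
      + by left; apply: delta_neq0; rewrite oner_eq0.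
    exists (- 1 *: delta_mx i 0); split.
    + by rewrite combination_delta scaleN1r.
    + by rewrite excess_delta normrN1; lra.
    + by left; apply: delta_neq0; rewrite oppr_eq0 oner_eq0.
  - exists (g + g'); split => /=.
    + by rewrite combinationD gE g'E.
    + by have := excessD g g'; lra.
    + have [gg'|] := eqVneq (g + g') 0; last by left.
      right; move/eqP: gg'; rewrite addrC addr_eq0 => /eqP gg'.
      move: g'e g'0; rewrite gg' excessN oppr_eq0 => g'e g'0.
      have [gz|/sum_norm_gt0] := eqVneq g 0; last by lra.
      move: g0 g'0; rewrite gz eqxx => -[//|c2] [//|c'2]; lra.
  - exists (t *: g); split => /=.
    + by rewrite combinationZ gE.
    + by rewrite (excessZ _ (ltW t0)) -mulrN ler_pM2l.
    + by case: g0 => g0; [left; rewrite scaler_eq0 negb_or gt_eqF|right; rewrite mulr_gt0].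
exists g; split; [|by rewrite gE|lra].
by case: g0 => //; lra.
Qed.

Lemma circuit_vecN (Cp Cm : {set 'I_n}) : circuit_vec Cm Cp = - circuit_vec Cp Cm.
Proof. by apply/colP => i; rewrite !mxE opprB. Qed.

Lemma is_circuitC (Cp Cm : {set 'I_n}) : is_circuit a Cp Cm -> is_circuit a Cm Cp.
Proof.
case=> dis dep ind CE; split; rewrite 1?finset.setUC// 1?disjoint_sym//.
Qed.

Lemma circuit_vec_relation (Cp Cm : {set 'I_n}) :
  is_circuit a Cp Cm -> a *m circuit_vec Cp Cm = 0.
Proof.
case=> _ _ _ CE.
have -> : a *m circuit_vec Cp Cm = \sum_i circuit_vec Cp Cm i 0 *: col i a.
  apply/colP => k; rewrite mxE summxE; apply: eq_bigr => i _.
  by rewrite !mxE mulrC.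
under eq_bigr do rewrite mxE scalerBl.
have sumE (C : {set 'I_n}) : \sum_i (i \in C)%:R *: col i a = \sum_(i in C) col i a.
  rewrite [RHS]big_mkcond; apply: eq_bigr => i _.
  by case: ifP; rewrite ?scale1r ?scale0r.
by rewrite sumrB !sumE CE subrr.
Qed.

Lemma combination_int (v : 'cV[int]_n) : combination (intcV F v) = intcV F (a *m v).
Proof.
apply/colP => k; rewrite summxE !mxE rmorph_sum; apply: eq_bigr => i _.
by rewrite !mxE rmorphM mulrC.
Qed.

(** Induction on the size of the support of g. Circuits exist inside the
    support; let v be a circuit vector, with the sign for which moving g in the
    direction v does not decrease the excess as long as no coordinate of g
    changes sign. If v has the same signs as g, then v itself has non-negative
    excess. Otherwise move g along v up to the first point where a coordinate
    vanishes, and continue with the new vector, whose support is smaller. *)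
Lemma circuit_excess (a_surj : forall w : 'cV[int]_d, exists v : 'cV[int]_n, a *m v = w)
    (a_unimod : unimodular a) g : g != 0 -> combination g = 0 -> 0 <= excess g ->
  exists Cp Cm, is_circuit a Cp Cm /\ 0 <= excess (intcV F (circuit_vec Cp Cm)).
Proof.
have [m] := ubnP #|[set i | g i 0 != 0]|; elim: m g => // m IH g gm g0 ga ge.
pose J := [set i | g i 0 != 0].
have depJ : ~ lin_indep a J.
  move=> /(lin_indep_ring a_surj a_unimod)/(_ (fun i => g i 0)) gJ.
  case/eqP: g0; apply/colP => i; rewrite [RHS]mxE.
  have [//|gi] := eqVneq (g i 0) 0; apply: gJ; last by rewrite inE.
  rewrite -[RHS]ga /combination [RHS](bigID (mem J)) /= [X in _ + X]big1 ?addr0//.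
  by move=> j; rewrite inE negbK => /eqP->; rewrite scale0r.
(* The rate of change of the excess of g along v, as long as no coordinate of g
   changes sign. *)
pose D (v : 'cV[F]_n) := \sum_i (w i 0 - Num.sg (g i 0) / 2) * v i 0.
have [Cp [Cm [CC sCJ D0]]] : exists Cp Cm, [/\ is_circuit a Cp Cm, Cp :|: Cm \subset J &
    0 <= D (intcV F (circuit_vec Cp Cm))].
  have [Cp [Cm [CC sCJ]]] := exists_circuit a_surj a_unimod depJ.
  have [D0|D0] := leP 0 (D (intcV F (circuit_vec Cp Cm))); first by exists Cp, Cm.
  exists Cm, Cp; split; [exact: is_circuitC|by rewrite finset.setUC|].
  rewrite circuit_vecN /intcV map_mxN /D.
  under eq_bigr do rewrite mxE mulrN.
  by rewrite sumrN oppr_ge0 ltW.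
set C := circuit_vec Cp Cm in D0; pose v := intcV F C.
have vE i : v i 0 = (i \in Cp)%:R - (i \in Cm)%:R.
  by rewrite /v /C !mxE rmorphB !rmorph_nat.
have v01 i : [\/ v i 0 = 0, v i 0 = 1 | v i 0 = - 1].
  rewrite vE; case: (i \in Cp); case: (i \in Cm); rewrite ?subrr ?subr0 ?sub0r.
  by constructor 1. by constructor 2. by constructor 3. by constructor 1.
have vJ i : g i 0 = 0 -> v i 0 = 0.
  move=> gi; have : i \notin Cp :|: Cm.
    by apply/negP => /(fintype.subsetP sCJ); rewrite inE gi eqxx.
  by rewrite vE inE negb_or => /andP[/negPf-> /negPf->]; rewrite subrr.
have va : combination v = 0.
  by rewrite combination_int circuit_vec_relation//; apply/colP => k; rewrite !mxE.
case: (boolP [forall i, 0 <= g i 0 * v i 0]) => [/forallP gv|].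
  exists Cp, Cm; split => //; rewrite -/v; suff -> : excess v = D v by [].
  apply: eq_bigr => i _; move: (gv i) (vJ i).
  case: (ltgtP (g i 0) 0) => gi; rewrite ?(ltr0_sg gi) ?(gtr0_sg gi) ?gi.
  - by rewrite nmulr_rge0// => vi _; rewrite ler0_norm//; lra.
  - by rewrite pmulr_rge0// => vi _; rewrite ger0_norm//; lra.
  - by move=> _ ->//; rewrite normr0; lra.
rewrite negb_forall => /existsP[i0]; rewrite -ltNge => gvi0.
have [i gvi imin] := @Order.TotalTheory.arg_minP _ _ _ i0 (fun i => g i 0 * v i 0 < 0) (fun i => `|g i 0|) gvi0.
(* Among the coordinates of g that move towards 0 along v, the first to reach 0. *)
set t := `|g i 0|.
have gi0 : g i 0 != 0 by apply/eqP => gi; move: gvi; rewrite gi mul0r ltxx.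
have t0 : 0 < t by rewrite normr_gt0.
have gvE j : (g + t *: v) j 0 = g j 0 + t * v j 0 by rewrite !mxE.
have normE j : `|(g + t *: v) j 0| = `|g j 0| + t * (Num.sg (g j 0) * v j 0).
  rewrite gvE; have := imin j; rewrite -/t => tj.
  case: (ltgtP (g j 0) 0) => gj; rewrite ?(ltr0_sg gj) ?(gtr0_sg gj) ?gj.
  - move: tj; rewrite (ltr0_norm gj); case: (v01 j) => ->.
    + by rewrite !mulr0 !addr0 ltr0_norm.
    + by rewrite !mulr1 => /(_ gj) tj; rewrite ler0_norm; lra.
    + by move=> _; rewrite ltr0_norm; lra.
  - move: tj; rewrite (gtr0_norm gj); case: (v01 j) => ->.
    + by rewrite !mulr0 !addr0 gtr0_norm.
    + by move=> _; rewrite gtr0_norm; lra.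
    + by rewrite mulrN1 oppr_lt0 => /(_ gj) tj; rewrite ger0_norm; lra.
  - by rewrite vJ// !mulr0 !addr0.
have [g'0|g'0] := eqVneq (g + t *: v) 0.
  (* Now g is a positive multiple of the opposite circuit vector. *)
  exists Cm, Cp; split; first exact: is_circuitC.
  have vE' : intcV F (circuit_vec Cm Cp) = t^-1 *: g.
    move/eqP: g'0; rewrite addr_eq0 => /eqP->; rewrite scalerN scalerA mulVf ?gt_eqF// scale1r.
    by rewrite circuit_vecN /intcV map_mxN.
  by rewrite vE' excessZ ?mulr_ge0// invr_ge0; exact: ltW.
apply: (IH (g + t *: v)) => //; last first.
- have -> : excess (g + t *: v) = excess g + t * D v; last by rewrite addr_ge0// mulr_ge0// ltW.
  rewrite /excess /D mulr_sumr -big_split /=; apply: eq_bigr => j _.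
  by rewrite normE gvE; lra.
- by rewrite combinationD combinationZ ga va scaler0 addr0.
- rewrite ltnS in gm; apply: leq_trans gm; apply: proper_card; apply/properP; split.
    apply/fintype.subsetP => j; rewrite !inE; apply: contra => /eqP gj.
    by rewrite gvE gj vJ// mulr0 addr0.
  exists i; rewrite !inE // negbK -normr_eq0 normE -/t.
  move: gvi; rewrite /t; case: (ltgtP (g i 0) 0) => gi; last by rewrite gi eqxx in gi0.
    by rewrite (ltr0_norm gi) (ltr0_sg gi) nmulr_rlt0//; case: (v01 i) => ->; rewrite ?ltxx//; lra.
  by rewrite (gtr0_norm gi) (gtr0_sg gi) pmulr_rlt0//; case: (v01 i) => ->; rewrite ?ltxx//; lra.
Qed.
End Excess.

(** * Minimal exponents of the theta function *)

Section ThetaExponent.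
Variables (R : realType) (n r d : nat).
Variables (a : 'M[int]_(d, n)) (b : 'M[int]_(r, n)).
Variables (iota : 'M[int]_(n, r)).
Hypothesis hiota : b *m iota = 1%:M.
Hypothesis exact_ab : forall v : 'cV[int]_n, a *m v = 0 <-> exists u, v = inclS b u.
Variables (s : 'cV[R]_r) (lam : 'cV[int]_n).

Lemma inclS_iota u : iota^T *m inclS b u = u.
Proof. by rewrite /inclS mulmxA -trmx_mul hiota trmx1 mul1mx. Qed.

Lemma inclSD u v : inclS b (u + v) = inclS b u + inclS b v.
Proof. by rewrite /inclS mulmxDr. Qed.

Lemma inclSN u : inclS b (- u) = - inclS b u.
Proof. by rewrite /inclS mulmxN. Qed.

Lemma inclS_eq0 u : inclS b u = 0 -> u = 0.
Proof. by move=> u0; rewrite -[u]inclS_iota u0 mulmx0. Qed.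

Definition offset : 'cV[R]_n := map_mx intr iota *m s.

Lemma dot_sE u : dot s (intcV R u) = \sum_i offset i 0 * (inclS b u i 0)%:~R.
Proof.
transitivity (dot offset (intcV R (inclS b u))).
  rewrite /dot /offset trmx_mul -mulmxA -[in LHS](inclS_iota u) /intcV map_mxM.
  by rewrite map_trmx.
by rewrite /dot mxE; apply: eq_bigr => i _; rewrite !mxE.
Qed.

(** The vector from the centre of the cube lam + beta + [0,1]^n to iota(s). *)
Definition displacement (u : 'cV[int]_r) : 'cV[R]_n :=
  \col_i (offset i 0 - ((lam + inclS b u) i 0)%:~R - 1 / 2).

Lemma theta_exponentD u0 u : theta_exponent b s lam (u0 + u) =
  theta_exponent b s lam u0 +
  \sum_i ((inclS b u i 0)%:~R ^+ 2 / 2 - displacement u0 i 0 * (inclS b u i 0)%:~R).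
Proof.
have int_dotE (x y : 'cV[int]_n) : (dot x y)%:~R = \sum_i (x i 0)%:~R * (y i 0)%:~R :> R.
  by rewrite /dot mxE rmorph_sum; apply: eq_bigr => i _; rewrite !mxE rmorphM.
rewrite /theta_exponent !dot_sE !int_dotE inclSD !mulr_suml -!sumrN -!big_split /=.
apply: eq_bigr => i _; rewrite !mxE !rmorphD /=; lra.
Qed.

Lemma theta_exponent0 : theta_exponent b s lam 0 = 0.
Proof.
rewrite /theta_exponent dot_sE /inclS mulmx0.
rewrite big1 => [|i _]; last by rewrite [X in X%:~R]mxE mulr0.
by rewrite /dot trmx0 mulmx0 mul0mx !mxE; lra.
Qed.

(** The exponent is a sum of quadratic functions of the coordinates of beta, so
    a value that is at most the value 0 taken at beta = 0 bounds all
    coordinates of beta, hence those of u, and only finitely many u compete. *)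
Lemma theta_exponent_min : exists u0, forall u,
  theta_exponent b s lam u0 <= theta_exponent b s lam u.
Proof.
pose w := displacement 0; pose Q := \sum_i (w i 0) ^+ 2.
have Q_ge0 : 0 <= Q by apply: sumr_ge0 => i _; exact: sqr_ge0.
have bound_v u : theta_exponent b s lam u <= 0 -> forall i,
    `|(inclS b u i 0)%:~R| <= Q + 1 + `|w i 0|.
  rewrite -[u]add0r theta_exponentD theta_exponent0 !add0r -/w => le0 i.
  set v := inclS b _ in le0 *.
  have : (\sum_i ((v i 0)%:~R - w i 0) ^+ 2) <= Q.
    rewrite -subr_le0 /Q -sumrB -(@pmulr_lle0 _ 2^-1) ?invr_gt0 ?ltr0n// mulr_suml.
    by apply: le_trans le0; apply: ler_sum => j _; lra.
  rewrite (bigD1 i) //=; set rest := \sum_(_ | _) _.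
  have rest0 : 0 <= rest by apply: sumr_ge0 => j _; apply: sqr_ge0.
  move=> le_Q; have : `|(v i 0)%:~R - w i 0| <= Q + 1.
    rewrite -ler_sqr ?nnegrE ?normr_ge0 ?addr_ge0//.
    rewrite real_normK ?num_real//; nra.
  have := ler_normD ((v i 0)%:~R - w i 0) (w i 0); rewrite subrK; lra.
pose B := \sum_i \sum_j `|(iota i j)%:~R| * (Q + 1 + `|w i 0|).
have bound_u u : theta_exponent b s lam u <= 0 -> forall j, `|(u j 0)%:~R| <= B.
  move=> le0 j; rewrite -[u]inclS_iota mxE rmorph_sum.
  apply: le_trans (ler_norm_sum _ _ _) _; apply: ler_sum => i _.
  rewrite (bigD1 j) //= mxE rmorphM normrM -[X in X <= _]addr0; apply: lerD.
    by apply: ler_wpM2l => //; exact: bound_v.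
  by apply: sumr_ge0 => k _; rewrite mulr_ge0// addr_ge0// addr_ge0.
pose N := (Num.truncn B).+1.
(* The shift by N encodes the integers in [-N, N] as elements of 'I_(2 * N).+1. *)
pose cand (f : {ffun 'I_r -> 'I_(2 * N).+1}) : 'cV[int]_r := \col_j ((f j)%:Z - N%:Z).
have candP u : theta_exponent b s lam u <= 0 -> exists f, cand f = u.
  move=> /bound_u uB; exists [ffun j => inord (absz (u j 0 + N%:Z))].
  have uN j : (absz (u j 0%R) <= N)%N.
    have := uB j; rewrite -intr_norm -abszE => /le_lt_trans/(_ (truncnS_gt _)).
    by rewrite -[_%:~R]/(_%:R) ltr_nat => /ltnW.
  apply/colP => j; rewrite !mxE ffunE inordK; last by have := uN j; lia.
  by have := uN j; lia.
pose f0 : {ffun 'I_r -> 'I_(2 * N).+1} := [ffun j => inord N].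
have f0E : cand f0 = 0.
  by apply/colP => j; rewrite !mxE ffunE inordK ?subrr//; lia.
have [f _ fmin] := @Order.TotalTheory.arg_minP _ R _ f0 xpredT
  (fun f => theta_exponent b s lam (cand f)) isT.
exists (cand f) => u.
have [/candP[f' <-]|u0] := leP (theta_exponent b s lam u) 0; first exact: fmin.
by apply: le_trans (ltW u0); rewrite -theta_exponent0 -f0E; exact: fmin.
Qed.

(** For beta in X_*(S) the displacement w may be replaced by w + a^T x without
    changing its pairing with beta. The increment of the exponent then becomes
    a sum of terms t^2 / 2 - c t with |c| < 1/2, positive for each non-zero
    integer t. *)
Lemma theta_exponent_strict_min u0 (x : 'cV[R]_d) :
  (forall i, `|displacement u0 i 0 + dot x (intcV R (col i a))| < 1 / 2) ->
  forall u, u != u0 -> theta_exponent b s lam u0 < theta_exponent b s lam u.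
Proof.
move=> xP u uu0; rewrite -[u](subrKC u0) theta_exponentD ltrDl.
set v := inclS b _.
have v0 : v != 0 by apply: contra uu0 => /eqP/inclS_eq0/eqP; rewrite subr_eq0.
have av : a *m v = 0 by apply/exact_ab; exists (u - u0).
have hv : \sum_i dot x (intcV R (col i a)) * (v i 0)%:~R = 0.
  transitivity (dot (\sum_i (v i 0)%:~R *: intcV R (col i a)) x).
    rewrite dot_suml; apply: eq_bigr => i _; rewrite dot_scalel mulrC; congr (_ * _).
    by rewrite /dot !mxE; apply: eq_bigr => k _; rewrite !mxE mulrC.
  have -> : \sum_i (v i 0)%:~R *: intcV R (col i a) = combination a (intcV R v).
    by rewrite /combination; apply: eq_bigr => i _; rewrite [in RHS]mxE.
  by rewrite combination_int av /dot /intcV map_mx0 trmx0 mul0mx mxE.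
rewrite -[X in _ < X]subr0 -[X in _ < _ - X]hv -sumrB.
have pos i : 0 <= (v i 0)%:~R ^+ 2 / 2 - displacement u0 i 0 * (v i 0)%:~R -
     dot x (intcV R (col i a)) * (v i 0)%:~R ?= iff (v i 0 == 0).
  set h := dot _ _; have := xP i; rewrite -/h ltr_norml => /andP[h1 h2].
  apply/leifP; have [->|vi] := eqVneq (v i 0) 0; first by apply/eqP; lra.
  have vi1 : 1 <= (v i 0)%:~R :> R \/ (v i 0)%:~R <= -1 :> R.
    have [vi0|vi0] : (1 <= v i 0) \/ (v i 0 <= -1) by lia.
      by left; rewrite -(ler_int R) in vi0.
    by right; rewrite -(ler_int R) in vi0.
  case: vi1 => vi1; nra.
have [i vi] : exists i, v i 0 != 0.
  apply/existsP; rewrite -negb_forall; apply: contra v0 => /forallP v0.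
  by apply/eqP/colP => i; rewrite [RHS]mxE; apply/eqP.
rewrite (bigD1 i) //=; apply: ltr_wpDr.
  by apply: sumr_ge0 => j _; apply: (leif_le (pos j)).
by rewrite (lt_leif (pos i)).
Qed.

(** A failure produces a circuit vector of non-negative excess. As its entries
    are 0 and +-1, the excess is minus the increment of the exponent along
    it, so by minimality both vanish; solving for the pairing with s gives an
    integer. *)
Lemma theta_min_cube (a_surj : forall w : 'cV[int]_d, exists v : 'cV[int]_n, a *m v = w)
    (a_unimod : unimodular a) (s_reg : s_regular a b s) u0 :
  (forall u, theta_exponent b s lam u0 <= theta_exponent b s lam u) ->
  exists x : 'cV[R]_d, forall i,
    `|displacement u0 i 0 + dot x (intcV R (col i a))| < 1 / 2.
Proof.
move=> u0min.
case: (cube_or_excess a (displacement u0)) => [//|[g [g0 ga ge]]]; exfalso.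
have [Cp [Cm [CC]]] := circuit_excess a_surj a_unimod g0 ga ge.
have /exact_ab[u uE] := circuit_vec_relation CC.
have := u0min (u0 + u); rewrite theta_exponentD lerDl => ge1 ge2.
have vE i : (circuit_vec Cp Cm i 0)%:~R ^+ 2 = `|(circuit_vec Cp Cm i 0)%:~R| :> R.
  rewrite mxE; case: (i \in Cp); case: (i \in Cm);
  by rewrite ?subrr ?subr0 ?sub0r ?rmorphN ?normrN ?sqrrN ?normr1 ?expr1n ?expr0n ?normr0.
have sum0 : \sum_i (displacement u0 i 0 * (inclS b u i 0)%:~R -
    (inclS b u i 0)%:~R ^+ 2 / 2) = 0.
  apply/le_anti/andP; split.
    by rewrite -oppr_ge0 -sumrN; under eq_bigr do rewrite opprB.
  rewrite -uE; under eq_bigr do rewrite vE.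
  apply: le_trans ge2 _; rewrite le_eqVlt; apply/orP; left; apply/eqP.
  by apply: eq_bigr => i _; rewrite intcVE.
apply: (s_reg _ _ CC u (esym uE) (\sum_i ((i \in Cp)%:Z +
   (lam + inclS b u0) i 0 * inclS b u i 0))).
rewrite dot_sE -[LHS]subr0 -[X in _ - X = _]sum0 -sumrB rmorph_sum; apply: eq_bigr => i _.
rewrite [displacement _ _ _]mxE rmorphD rmorphM /= -uE.
have dis : ~~ ((i \in Cp) && (i \in Cm)).
  case: CC => CpCm _ _ _; apply/negP => /andP[iCp].
  by rewrite (disjointFr CpCm iCp).
set L := (lam + _) i 0.
(* As beta_C has entries 0 and +-1, the half sum of its square and itself is the
   indicator of C_+. *)
have : (circuit_vec Cp Cm i 0)%:~R ^+ 2 / 2 + (circuit_vec Cp Cm i 0)%:~R / 2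
    = ((i \in Cp)%:Z)%:~R :> R.
  rewrite mxE; move: dis; case: (i \in Cp); case: (i \in Cm) => //= _;
  by rewrite ?subrr ?subr0 ?sub0r ?rmorphN /=; lra.
lra.
Qed.
End ThetaExponent.

(** * Alcoves and their floor vectors *)

Import numFieldNormedType.Exports.
Local Open Scope classical_set_scope.

Section AlcoveTopology.
Variables (R : realType) (n r d : nat).
Variables (a : 'M[int]_(d, n)).
Variables (iota : 'M[int]_(n, r)) (s : 'cV[R]_r).
Local Notation height := (height a iota s).
Local Notation complement := (arrangement_complement a iota s).

Lemma cvg_height i (F : set_system 'cV[R]_d) {FF : Filter F} (x : 'cV[R]_d) :
  (forall k, y k 0 @[y --> F] --> x k 0) -> height y i @[y --> F] --> height x i.
Proof.
move=> cF; rewrite /Defs.height; under eq_fun do rewrite dotE.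
rewrite dotE; apply: (@cvgD _ _ _ F); last by apply: cvg_cst.
elim: (index_enum _) => [|k l IH].
  by under eq_fun do rewrite big_nil; rewrite big_nil; exact: cvg_cst.
under eq_fun do rewrite big_cons; rewrite big_cons; apply: cvgD IH.
by apply: (@cvgM R _ F); [exact: cF|apply: cvg_cst].
Qed.

Lemma continuous_height i : continuous (height ^~ i).
Proof.
by move=> x; apply: (@cvg_height _ (nbhs x) (nbhs_filter x)) => k; exact: coord_continuous.
Qed.

Lemma continuous_segment (x y : 'cV[R]_d) :
  continuous (fun t : R => x + t *: (y - x)).
Proof.
move=> t A [P tP sPA].
have : \forall u \near t, forall ij : 'I_d * 'I_1, P ij.1 ij.2 ((x + u *: (y - x)) ij.1 ij.2).
  apply: (filter_forall (nbhs_filter t)) => -[i j] /=.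
  have : (x i j + u * (y - x) i j @[u --> t]) --> x i j + t * (y - x) i j.
    apply: cvgD; first by apply: cvg_cst.
    by apply: cvgM; [exact: cvg_id|apply: cvg_cst].
  have := tP i j; rewrite !mxE => tPij /(_ _ tPij); apply: (@filterS _ _ (nbhs_filter t)) => u /=.
  by rewrite !mxE.
by apply: (@filterS _ _ (nbhs_filter t)) => u /= uP; apply: sPA => i j; exact: (uP (i, j)).
Qed.

Lemma height_segment (x y : 'cV[R]_d) t i :
  height (x + t *: (y - x)) i = height x i + t * (height y i - height x i).
Proof.
rewrite /Defs.height dotDl dot_scalel dotDl -scaleN1r dot_scalel; ring.
Qed.

(** The image of a connected set under a height function is an interval; were
    the floors at x and y different, it would contain an integer. *)
Lemma floor_connected (B : set 'cV[R]_d) x y i : connected B -> B `<=` complement ->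
  B x -> B y -> Num.floor (height x i) = Num.floor (height y i).
Proof.
move=> cB sB; wlog suff le_floor : x y / B x -> B y ->
    Num.floor (height x i) <= Num.floor (height y i).
  by move=> Bx By; apply/le_anti; rewrite !le_floor.
move=> Bx By; rewrite leNgt; apply/negP => lt_floor.
have /connected_intervalP int_B : connected [set height z i | z in B].
  apply: connected_continuous_connected => //.
  exact/continuous_subspaceT/continuous_height.
pose m := Num.floor (height x i).
have [] := int_B (height y i) (height x i) _ _ m%:~R.
- by exists y.
- by exists x.
- rewrite floor_le andbT ltW//.
  by rewrite -floor_lt_int.
- by move=> z Bz /sB; apply.
Qed.

Lemma mu_alcove A x : Alc a iota s A -> A x ->
  mu a iota s A = \col_i Num.floor (height x i).
Proof.
move=> [x0 Dx0 <-] Ax; apply/colP => i; rewrite !mxE.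
apply: (floor_connected (B := connected_component complement x0)) => //.
- exact: component_connected.
- exact: connected_component_sub.
- by apply: (xgetPex 0); exists x.
Qed.

Lemma alcove_interior A : Alc a iota s A ->
  exists2 x, A x & forall i, (mu a iota s A i 0)%:~R < height x i < (mu a iota s A i 0 + 1)%:~R.
Proof.
move=> AA; move: (AA) => [x Dx Ax]; have xA : A x by rewrite -Ax; exact: connected_component_refl.
exists x => // i; rewrite (mu_alcove AA xA) mxE floorD1_gt andbT.
by rewrite lt_neqAle floor_le andbT eq_sym; apply/eqP; exact: Dx.
Qed.

Lemma interior_complement (v : 'cV[int]_n) x :
  (forall i, (v i 0)%:~R < height x i < (v i 0 + 1)%:~R) -> complement x.
Proof.
move=> xv i m hx; have := xv i; rewrite hx !ltr_int; lia.
Qed.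

Lemma alcove_of_interior (v : 'cV[int]_n) x :
  (forall i, (v i 0)%:~R < height x i < (v i 0 + 1)%:~R) ->
  exists2 A, Alc a iota s A & mu a iota s A = v.
Proof.
move=> xv; have Dx := interior_complement xv.
exists (connected_component complement x); first by exists x.
rewrite (@mu_alcove _ x); first last.
- exact: connected_component_refl.
- by exists x.
apply/colP => i; rewrite mxE; apply: floor_def.
by case/andP: (xv i) => /ltW -> ->.
Qed.

(** The points with prescribed floors, none of their heights being an integer,
    form a convex set, so a segment joins the two alcoves inside the complement
    of the arrangement. *)
Lemma mu_inj A A' : Alc a iota s A -> Alc a iota s A' ->
  mu a iota s A = mu a iota s A' -> A = A'.
Proof.
move=> AA AA' muE.
have [x xA xP] := alcove_interior AA; have [y yA' yP] := alcove_interior AA'.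
rewrite -muE in yP.
have [x0 _ Ax0] := AA; have [y0 _ Ay0] := AA'.
move: xA; rewrite -Ax0 => /same_connected_component ->.
move: yA'; rewrite -Ay0 => /same_connected_component ->.
apply: same_connected_component.
exists [set x + t *: (y - x) | t in `[0, 1]].
  split.
  - by exists 0; rewrite ?scale0r ?addr0//= in_itv /= lexx ler01.
  - move=> _ [t t01 <-]; apply: (@interior_complement (mu a iota s A)) => i.
    move: t01; rewrite /= in_itv /= => /andP[t0 t1].
    rewrite height_segment; have := xP i; have := yP i.
    move=> /andP[y1 y2] /andP[x1 x2].
    move: t0; rewrite le_eqVlt => /predU1P[<-|t_gt0]; first by rewrite mul0r addr0 x1.
    by apply/andP; split; nra.
  - apply: connected_continuous_connected; first exact: segment_connected.
    exact/continuous_subspaceT/continuous_segment.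
by exists 1; rewrite ?scale1r ?subrKC//= in_itv /= lexx ler01.
Qed.
End AlcoveTopology.

(** * Regular functions *)

Import -(notations) freeg mpoly.

Section RegularFunctions.
Variable R : realType.
Local Notation C := R[i].

Section Local.
Variables (m : nat) (W : set 'rV[C]_m) (w : 'rV[C]_m).
Implicit Types h k : 'rV[C]_m -> C.

(** The condition that [regular_on] imposes at each point. *)
Definition regular_at h := exists f g : mpoly m C, peval g w != 0 /\
  forall v, W v -> peval g v != 0 -> h v = peval f v / peval g v.

Lemma pevalM (f g : mpoly m C) v : peval (f * g) v = peval f v * peval g v.
Proof. exact: mevalM. Qed.

Lemma pevalD (f g : mpoly m C) v : peval (f + g) v = peval f v + peval g v.
Proof. exact: mevalD. Qed.

Lemma regular_at_cst c : regular_at (fun=> c).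
Proof.
exists (mpolyC m c), 1; rewrite /peval meval1 oner_neq0; split => // v _ _.
by rewrite /peval mevalC meval1 divr1.
Qed.

Lemma regular_at_coord i : regular_at (fun v => v 0 i).
Proof.
exists (mpolyX C (mnm1 i)), 1; rewrite /peval meval1 oner_neq0; split => // v _ _.
by rewrite /peval mevalXU meval1 divr1.
Qed.

Lemma regular_atD h k : regular_at h -> regular_at k -> regular_at (fun v => h v + k v).
Proof.
move=> [f [g [gw hE]]] [f' [g' [gw' kE]]].
exists (f * g' + f' * g), (g * g'); rewrite pevalM mulf_neq0//; split => // v Wv.
rewrite pevalM mulf_eq0 negb_or => /andP[gv gv'].
by rewrite hE// kE// pevalD !pevalM; field; apply/andP.
Qed.

Lemma regular_atM h k : regular_at h -> regular_at k -> regular_at (fun v => h v * k v).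
Proof.
move=> [f [g [gw hE]]] [f' [g' [gw' kE]]].
exists (f * f'), (g * g'); rewrite pevalM mulf_neq0//; split => // v Wv.
rewrite pevalM mulf_eq0 negb_or => /andP[gv gv'].
by rewrite hE// kE// !pevalM; field; apply/andP.
Qed.

(** Multiplying the denominator by a numerator and a denominator of k keeps the
    new fraction within the locus where k is invertible. *)
Lemma regular_at_local h h' k : W w -> regular_at k -> k w != 0 -> regular_at h' ->
  (forall v, W v -> k v != 0 -> h v = h' v) -> regular_at h.
Proof.
move=> Ww [f [g [gw kE]]] kw [f' [g' [gw' h'E]]] hh'.
exists (f * g * f'), (f * g * g').
have fw : peval f w != 0.
  by apply: contra kw => /eqP fw; rewrite kE// fw mul0r.
rewrite !pevalM !mulf_neq0//; split => // v Wv.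
rewrite !pevalM !mulf_eq0 !negb_or => /andP[/andP[fv gv] gv'].
have kv : k v != 0 by rewrite kE// mulf_neq0// invr_eq0.
by rewrite hh'// h'E//; field; rewrite fv gv gv'.
Qed.

Lemma regular_atV h : W w -> regular_at h -> h w != 0 -> regular_at (fun v => (h v)^-1).
Proof.
move=> Ww [f [g [gw hE]]] hw.
exists (g * g), (f * g).
have fw : peval f w != 0.
  by apply: contra hw => /eqP fw; rewrite hE// fw mul0r.
rewrite !pevalM !mulf_neq0//; split => // v Wv.
rewrite !pevalM !mulf_eq0 !negb_or => /andP[fv gv].
by rewrite hE//; field; rewrite fv gv.
Qed.

Lemma regular_at_prod (I : Type) (l : seq I) (F : I -> 'rV[C]_m -> C) :
  (forall i, regular_at (F i)) -> regular_at (fun v => \prod_(i <- l) F i v).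
Proof.
move=> regF; elim: l => [|i l IH].
  by under eq_fun do rewrite big_nil; exact: regular_at_cst.
by under eq_fun do rewrite big_cons; exact: regular_atM.
Qed.

Lemma regular_at_sum (I : Type) (l : seq I) (F : I -> 'rV[C]_m -> C) :
  (forall i, regular_at (F i)) -> regular_at (fun v => \sum_(i <- l) F i v).
Proof.
move=> regF; elim: l => [|i l IH].
  by under eq_fun do rewrite big_nil; exact: regular_at_cst.
by under eq_fun do rewrite big_cons; exact: regular_atD.
Qed.

Lemma regular_atX h e : regular_at h -> regular_at (fun v => h v ^+ e).
Proof.
move=> regh; elim: e => [|e IH].
  by under eq_fun do rewrite expr0; exact: regular_at_cst.
by under eq_fun do rewrite exprS; exact: regular_atM.
Qed.

Lemma regular_atXz h (e : int) : W w -> regular_at h -> (e != 0 -> h w != 0) ->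
  regular_at (fun v => h v ^ e).
Proof.
move=> Ww regh; case: e => e hw; first exact: regular_atX.
under eq_fun do rewrite NegzE -exprz_inv.
by apply: regular_atX; apply: regular_atV => //; exact: hw.
Qed.
End Local.

Lemma regular_at_sub m (W W' : set 'rV[C]_m) w h : W' `<=` W ->
  regular_at W w h -> regular_at W' w h.
Proof.
by move=> sub [f [g [gw hE]]]; exists f, g; split => // v /sub; exact: hE.
Qed.

Lemma regular_at_ext m (W : set 'rV[C]_m) w h h' : (forall v, W v -> h v = h' v) ->
  regular_at W w h' -> regular_at W w h.
Proof.
by move=> hh' [f [g [gw hE]]]; exists f, g; split => // v Wv; rewrite hh'//; exact: hE.
Qed.

(** Substituting regular functions into the numerator and the denominator of h
    gives regular functions, whose quotient is defined near w. *)
Lemma regular_at_comp m k (W : set 'rV[C]_m) (W' : set 'rV[C]_k)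
    (u : 'rV[C]_m -> 'rV[C]_k) h w : W w -> (forall v, W v -> W' (u v)) ->
  (forall i, regular_at W w (fun v => u v 0 i)) -> regular_at W' (u w) h ->
  regular_at W w (h \o u).
Proof.
move=> Ww WW' ureg [f [g [gw hE]]].
have peval_reg (q : mpoly k C) : regular_at W w (fun v => peval q (u v)).
  under eq_fun do rewrite /peval mevalE.
  apply: regular_at_sum => mm; apply: regular_atM; first exact: regular_at_cst.
  by apply: regular_at_prod => i; exact: regular_atX.
apply: (regular_at_local (k := fun v => peval g (u v))
   (h' := fun v => peval f (u v) * (peval g (u v))^-1)) => //.
  by apply: regular_atM => //; exact: regular_atV.
by move=> v Wv gv /=; rewrite hE//; exact: WW'.
Qed.
End RegularFunctions.

(** * The torus action on semistable points *)

Section TorusAction.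
Variables (R : realType) (n r : nat) (b : 'M[int]_(r, n)) (eta : 'cV[int]_r).
Local Notation C := R[i].
Local Notation pt := 'rV[C]_(n + n).
Local Notation grp := 'rV[C]_(n + 1).
Implicit Types (p : pt) (g : grp) (s : 'rV[C]_r) (pv : pt * C).
Local Notation Zss := (@Zss R n r b eta).
Local Notation semistable := (@semistable R n r b eta).

Definition torus_inv m (t : 'rV[C]_m) : 'rV[C]_m := \row_i (t 0 i)^-1.

Lemma torusM m (t t' : 'rV[C]_m) : torus t -> torus t' -> torus (torus_mul t t').
Proof. by move=> tt tt' i; rewrite mxE mulf_neq0. Qed.

Lemma torus1 m : torus (const_mx 1 : 'rV[C]_m).
Proof. by move=> i; rewrite mxE oner_neq0. Qed.

Lemma torusV m (t : 'rV[C]_m) : torus t -> torus (torus_inv t).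
Proof. by move=> tt i; rewrite mxE invr_eq0. Qed.

Lemma torus_mulC m (t t' : 'rV[C]_m) : torus_mul t t' = torus_mul t' t.
Proof. by apply/rowP => i; rewrite !mxE mulrC. Qed.

Lemma torus_mulVK m (t t' : 'rV[C]_m) : torus t ->
  torus_mul (torus_mul t' (torus_inv t)) t = t'.
Proof. by move=> tt; apply/rowP => i; rewrite !mxE mulfVK. Qed.

Lemma embSEl s i : embS b s 0 (lshift 1 i) = \prod_j s 0 j ^ b j i.
Proof. by rewrite /embS row_mxEl mxE. Qed.

Lemma embSEr s i : embS b s 0 (rshift n i) = 1.
Proof. by rewrite /embS row_mxEr mxE. Qed.

Lemma torus_embS s : torus s -> torus (embS b s).
Proof.
move=> ts k; case: (split_ordP k) => i ->; last by rewrite embSEr oner_neq0.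
by rewrite embSEl; apply/prodf_neq0 => j _; exact: expfz_neq0.
Qed.

Lemma torus_mulE m (t t' : 'rV[C]_m) i : torus_mul t t' 0 i = t 0 i * t' 0 i.
Proof. by rewrite mxE. Qed.

Lemma embSM s s' : embS b (torus_mul s s') = torus_mul (embS b s) (embS b s').
Proof.
apply/rowP => k; rewrite torus_mulE; case: (split_ordP k) => i ->.
  rewrite embSEl (embSEl s) (embSEl s') -big_split /=; apply: eq_bigr => j _.
  by rewrite torus_mulE expfzMl.
by rewrite embSEr (embSEr s) (embSEr s') mulr1.
Qed.

Lemma embS1 : embS b (const_mx 1) = const_mx 1 :> grp.
Proof.
apply/rowP => k; rewrite [RHS]mxE; case: (split_ordP k) => i ->; last by rewrite embSEr.
by rewrite embSEl big1// => j _; rewrite mxE exp1rz.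
Qed.

Lemma charTM lam g g' : charT lam (torus_mul g g') = charT lam g * charT lam g'.
Proof.
rewrite /charT -big_split /=; apply: eq_bigr => i _.
by rewrite !mxE expfzMl.
Qed.

Lemma charT1 lam : charT lam (const_mx 1 : grp) = 1.
Proof. by rewrite /charT big1// => i _; rewrite !mxE exp1rz. Qed.

Lemma charT_neq0 lam g : torus g -> charT lam g != 0.
Proof. by move=> tg; apply/prodf_neq0 => i _; rewrite mxE expfz_neq0. Qed.

(** A character of T restricted to S depends only on its image under b. *)
Lemma charT_embS lam s : torus s ->
  charT lam (embS b s) = \prod_j s 0 j ^ ((b *m lam) j 0).
Proof.
move=> ts; rewrite /charT /embS.
under eq_bigr => i _.
  rewrite row_mxKl mxE.
  rewrite (big_morph (fun x : C => x ^ lam i 0) (id1 := 1) (op1 := *%R)); last 2 first.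
  - by move=> x y; rewrite expfzMl.
  - by rewrite exp1rz.
  over.
rewrite exchange_big /=; apply: eq_bigr => j _.
rewrite mxE (big_morph (fun e : int => s 0 j ^ e) (id1 := 1) (op1 := *%R))//; last first.
  by move=> x y; rewrite expfzDr.
by apply: eq_bigr => i _; rewrite exprz_exp.
Qed.

Lemma gactEl g p i : gact g p 0 (lshift n i) =
  (g 0 (rshift n 0))^-1 * (g 0 (lshift 1 i) * p 0 (lshift n i)).
Proof. by rewrite /gact row_mxEl !mxE. Qed.

Lemma gactEr g p i : gact g p 0 (rshift n i) =
  (g 0 (rshift n 0))^-1 * ((g 0 (lshift 1 i))^-1 * p 0 (rshift n i)).
Proof. by rewrite /gact row_mxEr !mxE. Qed.

Lemma gact1 p : gact (const_mx 1) p = p.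
Proof.
apply/rowP => k; case: (split_ordP k) => i ->.
  by rewrite gactEl !mxE invr1 !mul1r.
by rewrite gactEr !mxE invr1 !mul1r.
Qed.

Lemma gactM g g' p : gact (torus_mul g g') p = gact g (gact g' p).
Proof.
apply/rowP => k; case: (split_ordP k) => i ->.
  by rewrite !gactEl !mxE invfM; ring.
by rewrite !gactEr !mxE !invfM; ring.
Qed.

Lemma gact_neq0 g p k : torus g -> (gact g p 0 k != 0) = (p 0 k != 0).
Proof.
move=> tg; case: (split_ordP k) => i ->.
  by rewrite gactEl !mulf_eq0 invr_eq0 (negPf (tg _)) (negPf (tg _)).
by rewrite gactEr !mulf_eq0 !invr_eq0 (negPf (tg _)) (negPf (tg _)).
Qed.

(** A semi-invariant is a sum of monomials of the same weight, one of which does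
    not vanish where the sum does not. Semistability is thereby a condition on
    the set of vanishing coordinates, invariant under all of T x SS. *)
Lemma semistableP p : semistable p <-> exists m (mm : multinom (n + n)),
  [/\ (0 < m)%N, monomial_weight b mm = - (eta *+ m) & forall k, mm k != 0%N -> p 0 k != 0].
Proof.
split=> [[m [f [m0 fw fp]]]|[m [mm [m0 mmw mmp]]]].
  exists m; have [mm mmf mmp] : exists2 mm, mm \in msupp f & \prod_k p 0 k ^+ mm k != 0.
    apply: contrapT => H; case/eqP: fp; rewrite /peval mevalE big_seq big1// => mm mmf.
    have [->|mmp] := eqVneq (\prod_k p 0 k ^+ mm k) 0; first by rewrite mulr0.
    by case: H; exists mm.
  exists mm; split => //; first exact: fw.
  move=> k mmk; move/prodf_neq0: mmp => /(_ k isT).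
  by rewrite expf_eq0 lt0n mmk.
exists m, (mpolyX C mm); split => //.
  by move=> m'; rewrite msuppX inE => /eqP->.
rewrite /peval mevalX; apply/prodf_neq0 => k _.
by rewrite expf_eq0 lt0n negb_and negbK; have := mmp k; case: eqP => //= _ ->.
Qed.

Lemma Zss_gact g p : torus g -> Zss p -> Zss (gact g p).
Proof.
move=> tg [mp /semistableP[m [mm [m0 mmw mmp]]]]; split; last first.
  by apply/semistableP; exists m, mm; split => // k /mmp; rewrite gact_neq0.
have -> : moment_map b (gact g p) = (g 0 (rshift n 0))^-1 ^+ 2 *: moment_map b p.
  rewrite /moment_map scaler_sumr; apply: eq_bigr => i _; rewrite scalerA.
  congr (_ *: _); rewrite [lsubmx _ _ _]mxE gactEl [rsubmx _ _ _]mxE gactEr !mxE.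
  have := tg (lshift 1 i); set t := g 0 (lshift 1 i); set si := g 0 _; move=> t0.
  by rewrite mulrACA [X in _ * X = _]mulrACA mulfV// mul1r expr2.
by rewrite mp scaler0.
Qed.

Lemma orbitS_refl p : orbitS b p p.
Proof. by exists (const_mx 1); rewrite ?embS1 ?gact1//; exact: torus1. Qed.

Lemma orbitS_gact s p : torus s -> orbitS b (gact (embS b s) p) = orbitS b p.
Proof.
move=> ts; apply/seteqP; split => _ [s' ts' <-].
  by exists (torus_mul s' s); [exact: torusM|rewrite embSM gactM].
exists (torus_mul s' (torus_inv s)); first exact/torusM/torusV.
by rewrite -gactM -embSM torus_mulVK.
Qed.

Lemma orbitS_eq p p' : orbitS b p = orbitS b p' ->
  exists2 s, torus s & p' = gact (embS b s) p.
Proof.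
by move=> E; have := orbitS_refl p'; rewrite -E => -[s ts <-]; exists s.
Qed.

Lemma Xact_orbitS g p : Xact g (orbitS b p) = orbitS b (gact g p).
Proof.
apply/seteqP; split => [_ [_ [s ts <-] <-]|_ [s ts <-]].
  by exists s; [exact: ts|rewrite -!gactM torus_mulC].
exists (gact (embS b s) p); first by exists s.
by rewrite -!gactM torus_mulC.
Qed.

Lemma LactM lam g g' (pv : pt * C) :
  Lact lam g (Lact lam g' pv) = Lact lam (torus_mul g g') pv.
Proof. by rewrite /Lact /= gactM charTM mulrA. Qed.

Lemma Lact1 lam (pv : pt * C) : Lact lam (const_mx 1) pv = pv.
Proof. by case: pv => p v; rewrite /Lact /= gact1 charT1 mul1r. Qed.

Lemma Lorbit_refl lam pv : Lorbit b lam pv pv.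
Proof. by exists (const_mx 1); rewrite ?embS1 ?Lact1//; exact: torus1. Qed.

Lemma Lorbit_Lact lam s pv : torus s ->
  Lorbit b lam (Lact lam (embS b s) pv) = Lorbit b lam pv.
Proof.
move=> ts; apply/seteqP; split => _ [s' ts' <-].
  by exists (torus_mul s' s); [exact: torusM|rewrite LactM embSM].
exists (torus_mul s' (torus_inv s)); first exact/torusM/torusV.
by rewrite LactM -embSM torus_mulVK.
Qed.

Lemma Lorbit_eq lam pv pv' : Lorbit b lam pv = Lorbit b lam pv' ->
  exists2 s, torus s & pv' = Lact lam (embS b s) pv.
Proof.
by move=> E; have := Lorbit_refl lam pv'; rewrite -E => -[s ts <-]; exists s.
Qed.

Lemma Lact_Lorbit lam g pv : Lact lam g @` Lorbit b lam pv = Lorbit b lam (Lact lam g pv).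
Proof.
apply/seteqP; split => [_ [_ [s ts <-] <-]|_ [s ts <-]].
  by exists s; [exact: ts|rewrite !LactM torus_mulC].
exists (Lact lam (embS b s) pv); first by exists s.
by rewrite !LactM torus_mulC.
Qed.

Lemma fst_Lorbit lam pv : fst @` Lorbit b lam pv = orbitS b pv.1.
Proof.
apply/seteqP; split => [_ [_ [s ts <-] <-]|_ [s ts <-]]; first by exists s.
by exists (Lact lam (embS b s) pv) => //; exists s.
Qed.
End TorusAction.

(** * The line bundles of characters *)

Section LineBundle.
Variables (R : realType) (n r d : nat) (a : 'M[int]_(d, n)).
Variables (b : 'M[int]_(r, n)) (eta : 'cV[int]_r).
Local Notation C := R[i].
Local Notation pt := 'rV[C]_(n + n).
Local Notation grp := 'rV[C]_(n + 1).
Local Notation Xpt := (set pt).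
Implicit Types (p : pt) (g : grp) (s : 'rV[C]_r) (pv : pt * C) (lam : 'cV[int]_n).
Local Notation Zss := (@Zss R n r b eta).
Local Notation X := (@X R n r b eta).
Local Notation over := (@Defs.over R n r b eta).
Hypothesis hX : toric_hyperkahler_data a b eta.

Definition vanishing p : {set 'I_n} :=
  [set i | (p 0 (lshift n i) == 0) && (p 0 (rshift n i) == 0)].

(** If these a_i were dependent, they would contain a circuit C. The relation
    beta_C pairs to zero with b_i for every i outside the vanishing set, while
    semistability writes a multiple of eta in terms of exactly those b_i; so eta
    would be orthogonal to beta_C. *)
Lemma vanishing_indep p : Zss p -> lin_indep a (vanishing p).
Proof.
move=> [_ /semistableP[m [mm [m0 mmw mmp]]]]; apply: contrapT.
move=> /(exists_circuit (thk_a_surj hX) (thk_unimodular hX))[Cp [Cm [CC sC]]].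
have /(thk_exact hX)[u uE] := circuit_vec_relation CC.
have /eqP[] := thk_generic hX CC (esym uE).
have : dot (- (eta *+ m)) u = 0.
  rewrite -mmw /monomial_weight dot_suml big1// => i _; rewrite dot_scalel.
  have -> : dot (col i b) u = circuit_vec Cp Cm i 0.
    by rewrite uE /dot /inclS !mxE; apply: eq_bigr => k _; rewrite !mxE.
  have [/(fintype.subsetP sC)|] := boolP (i \in Cp :|: Cm).
    rewrite inE => /andP[xi yi].
    have mm0 k : p 0 k == 0 -> mm k = 0%N.
      by move=> pk; apply/eqP; apply: contraTT pk => /mmp.
    by rewrite !mm0// subrr mul0r.
  by rewrite inE negb_or mxE => /andP[/negPf-> /negPf->]; rewrite subrr mulr0.
rewrite -scaleN1r dot_scalel -scaler_nat dot_scalel mulN1r => /eqP.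
by rewrite oppr_eq0 mulf_eq0 pnatr_eq0 gtn_eqF//= => /eqP.
Qed.

Lemma exact_tr (x : 'cV[int]_d) : b *m (a^T *m x) = 0.
Proof.
have ab : a *m b^T = 0.
  apply/matrixP => i j; rewrite [RHS]mxE.
  have /(thk_exact hX)/colP/(_ i) : exists u, b^T *m delta_mx j 0 = inclS b u.
    by exists (delta_mx j 0).
  by rewrite mulmxA -colE mxE [RHS]mxE.
by rewrite mulmxA -[b]trmxK -trmx_mul ab trmx0 mul0mx.
Qed.

(** Correct lam by an element of X^*(H) = Ker b with prescribed values on the
    vanishing set, which exists by independence and unimodularity. *)
Lemma supported_weight p lam : Zss p -> exists lam', b *m lam' = b *m lam /\
  forall i, i \in vanishing p -> lam' i 0 = 0.
Proof.
move=> /vanishing_indep/(lin_indep_interp (thk_a_surj hX) (thk_unimodular hX)).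
move=> /(_ lam)[x xE].
exists (lam - a^T *m x); split; first by rewrite mulmxBr exact_tr subr0.
by move=> i /xE; rewrite !mxE => ->; rewrite subrr.
Qed.

(** For lam supported off the vanishing set of p0, a Laurent monomial in
    coordinates that do not vanish at p0, of the S-weight needed for
    v * frame p to be constant on the S-orbits of pairs (p, v). *)
Definition frame (p0 : pt) (lam : 'cV[int]_n) (p : pt) : C :=
  \prod_i (if p0 0 (lshift n i) != 0 then p 0 (lshift n i) ^ (- lam i 0)
           else p 0 (rshift n i) ^ (lam i 0)).

Definition nonvanishing (p0 p : pt) : Prop := forall k, p0 0 k != 0 -> p 0 k != 0.

Lemma frame_neq0 p0 lam p : (forall i, i \in vanishing p0 -> lam i 0 = 0) ->
  nonvanishing p0 p -> frame p0 lam p != 0.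
Proof.
move=> lam0 pp0; apply/prodf_neq0 => i _; case: ifPn => [/pp0|xi]; first exact: expfz_neq0.
rewrite expfz_eq0 negb_and; have [/lam0->|] := boolP (i \in vanishing p0).
  by rewrite eqxx.
by rewrite inE (negbNE xi) /= => /pp0->; rewrite orbT.
Qed.

Lemma frame_embS p0 lam p s : torus s ->
  charT lam (embS b s) * frame p0 lam (gact (embS b s) p) = frame p0 lam p.
Proof.
move=> /(torus_embS b) ts; rewrite /charT /frame -big_split /=; apply: eq_bigr => i _.
rewrite mxE gactEl gactEr embSEr invr1 !mul1r; have := ts (lshift 1 i).
move: (embS b s 0 _) => t t0; case: ifP => _.
  by rewrite expfzMl mulrA -expfzDr// subrr expr0z mul1r.
by rewrite expfzMl mulrA -expfzMl mulfV// exp1rz mul1r.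
Qed.

Lemma regular_frame p0 lam W p : W p -> (forall i, i \in vanishing p0 -> lam i 0 = 0) ->
  nonvanishing p0 p -> regular_at W p (frame p0 lam).
Proof.
move=> Wp lam0 pp0; apply: regular_at_prod => i.
case: (boolP (p0 0 (lshift n i) != 0)) => [/pp0|] xi.
  by apply: regular_atXz => //; exact: regular_at_coord.
apply: regular_atXz => //; first exact: regular_at_coord.
have [/lam0->|] := boolP (i \in vanishing p0); first by rewrite eqxx.
by rewrite inE (negbNE xi) /= => /pp0.
Qed.

Definition chart_open (p0 : pt) : set Xpt :=
  [set x | exists2 p, x = orbitS b p & Zss p /\ nonvanishing p0 p].

Lemma over_chart_open p0 p : over (chart_open p0) p <-> Zss p /\ nonvanishing p0 p.
Proof.
split=> [[Zp [p' /orbitS_eq[s ts p'E] [_ pp0]]]|[Zp pp0]]; last by split => //; exists p.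
split => // k /pp0; rewrite p'E gact_neq0//; exact: torus_embS.
Qed.

Lemma open_chart p0 : open_in_X b eta (chart_open p0).
Proof.
split; first by move=> _ [p -> [Zp _]]; exists p.
exists [set \prod_(k | p0 0 k != 0) mpolyX C (mnm1 k)].
apply/seteqP; split => p /=.
  move=> /over_chart_open[Zp pp0]; split => //; eexists; first by [].
  rewrite /peval rmorph_prod; apply/prodf_neq0 => k /pp0.
  by rewrite /= mevalXU.
move=> [Zp [_ ->]]; rewrite /peval rmorph_prod /= => /prodf_neq0 pp0.
by apply/over_chart_open; split => // k /pp0; rewrite mevalXU.
Qed.

(** With lam' supported off the vanishing set of p0 and of the same S-weight as
    lam, the function [frame p0 lam'] is invertible where the coordinates that
    are non-zero at p0 do not vanish. *)
Lemma chart_exists lam p0 : Zss p0 ->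
  exists2 c : chart R n, Lchart b eta lam c & chart_dom c (orbitS b p0).
Proof.
move=> Zp0; have [lam' [blam lam0]] := supported_weight lam Zp0.
pose h := frame p0 lam'.
pose phi (e : ambient R n) : 'rV[C]_1 := xget 0
  [set z | exists p v, [/\ over (chart_open p0) p, e = Lorbit b lam (p, v) &
     z = const_mx (v * h p)]].
exists (Chart (chart_open p0) phi); last by exists p0 => //; split => // k.
exists (chart_open p0), phi, h; split => //.
- exact: open_chart.
- move=> p Op; have /over_chart_open[_ pp0] := Op; exact: (regular_frame Op lam0 pp0).
- by move=> p /over_chart_open[_ pp0]; exact: frame_neq0.
- move=> p v Op; rewrite /phi; case: xgetP => [_ -> [p' [v' [Op' E ->]]]|/(_ (const_mx (v * h p)))].
    have [s ts [-> ->]] := Lorbit_eq E.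
    rewrite /h -(frame_embS p0 lam' p ts).
    have -> : charT lam (embS b s) = charT lam' (embS b s) by rewrite !charT_embS// blam.
    congr const_mx; ring.
  by case; exists p, v.
Qed.

(** Compare the values of phi on two representatives of the same point of the
    bundle. *)
Lemma chart_equivariant lam U (phi : ambient R n -> 'rV[C]_1) (h : pt -> C) p s :
  (forall p v, over U p -> phi (Lorbit b lam (p, v)) = const_mx (v * h p)) ->
  over U p -> torus s ->
  charT lam (embS b s) * h (gact (embS b s) p) = h p.
Proof.
move=> phiE Op ts.
have Op' : over U (gact (embS b s) p).
  case: Op => Zp Up; split; first by apply: Zss_gact Zp; exact: torus_embS.
  by rewrite orbitS_gact.
have := phiE _ 1 Op; rewrite mul1r -(Lorbit_Lact b lam (p, 1) ts) phiE//= mulr1.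
by move=> /rowP/(_ 0); rewrite !mxE.
Qed.

(** Matrices of transition functions are functions of orbits; they are computed
    at a representative, and [chart_equivariant] shows that its choice is
    immaterial. *)
Definition point_of (x : Xpt) : pt := xget 0 [set p | Zss p /\ x = orbitS b p].

Lemma point_ofP p : Zss p -> exists2 s, torus s & point_of (orbitS b p) = gact (embS b s) p.
Proof.
move=> Zp; rewrite /point_of; case: xgetP => [_ -> [Zp' /orbitS_eq]//|/(_ p)].
by case.
Qed.

Lemma over_gact U s p : torus s -> over U p -> over U (gact (embS b s) p).
Proof.
move=> ts [Zp Up]; split; first by apply: Zss_gact Zp; exact: torus_embS.
by rewrite orbitS_gact.
Qed.

Lemma mulmx_const1 (u v : C) : (const_mx u : 'M[C]_(1, 1)) *m (const_mx v : 'M[C]_(1, 1)) = const_mx (u * v).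
Proof. by apply/rowP => i; rewrite mxE big_ord1 !mxE. Qed.

Lemma regular_charT lam (W : set 'rV[C]_((n + 1) + (n + n))) w : W w ->
  torus (lsubmx w) -> regular_at W w (fun w => charT lam (lsubmx w)).
Proof.
move=> Ww tw; apply: regular_at_prod => i; apply: regular_atXz => //.
  by under eq_fun do rewrite !mxE; exact: regular_at_coord.
by move=> _; rewrite mxE; exact: tw.
Qed.

Lemma regular_at_rsubmx (W : set 'rV[C]_((n + 1) + (n + n))) w l :
  regular_at W w (fun w => rsubmx w 0 l).
Proof. by under eq_fun do rewrite mxE; exact: regular_at_coord. Qed.

Lemma regular_gact (W : set 'rV[C]_((n + 1) + (n + n))) w k : W w ->
  torus (lsubmx w) -> regular_at W w (fun w => gact (lsubmx w) (rsubmx w) 0 k).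
Proof.
move=> Ww tw.
have gE l : regular_at W w (fun w => lsubmx w 0 l).
  by under eq_fun do rewrite mxE; exact: regular_at_coord.
have pE l := regular_at_rsubmx W w l.
case: (split_ordP k) => i ->.
  under eq_fun do rewrite gactEl.
  apply: regular_atM; first by apply: regular_atV.
  exact: regular_atM.
under eq_fun do rewrite gactEr.
apply: regular_atM; first by apply: regular_atV.
by apply: regular_atM => //; exact: regular_atV.
Qed.

(** In charts given by h and h', the transition function is h' / h and the
    action of g sends a coordinate at p to its multiple by
    g^lam h'(g p) / h(p). *)
Lemma Lbundle_is_vbundle lam : is_vbundle b eta (Lbundle R b eta lam).
Proof.
split => /=.
- by move=> _ [[p v] /= Zp ->]; rewrite fst_Lorbit; exists p.
- by move=> _ [U [phi [h [->]]]].
- by move=> _ [p Zp <-]; exact: chart_exists.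
- move=> _ [U [phi [h [-> [UX _] _ h0 phiE]]]] x /= Ux v.
  have [p Zp pE] := UX _ Ux; have Op : over U p by split => //; rewrite pE.
  exists (Lorbit b lam (p, v 0 0 / h p)); split.
    split; [by exists (p, v 0 0 / h p)|by rewrite fst_Lorbit|].
    rewrite phiE// divfK ?h0//; apply/rowP => i; rewrite mxE.
    by congr (v _ _); apply/ord_inj; case: i => -[].
  move=> _ [[[p' v'] /= Zp' ->]]; rewrite fst_Lorbit /= -pE => /esym/orbitS_eq[s ts p'E].
  have -> : Lorbit b lam (p', v') = Lorbit b lam (p, (charT lam (embS b s))^-1 * v').
    rewrite -[RHS](Lorbit_Lact b lam _ ts) /Lact /= -p'E mulrA mulfV ?mul1r//.
    by apply: charT_neq0; exact: torus_embS.
  by rewrite phiE// => <-; rewrite mxE mulfK// h0.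
- move=> _ _ [U [phi [h [-> oU hreg h0 phiE]]]] [U' [phi' [h' [-> oU' h'reg h'0 phi'E]]]] /=.
  exists (fun x => const_mx (h' (point_of x) / h (point_of x))).
    move=> i j p Op.
    have [OU OU'] : over U p /\ over U' p by case: Op => Zp [].
    apply: (@regular_at_ext _ _ _ _ _ (fun p => h' p / h p)).
      move=> q [Zq [Uq U'q]]; rewrite mxE; have [s ts ->] := point_ofP Zq.
      rewrite -(chart_equivariant phiE (conj Zq Uq) ts).
      rewrite -(chart_equivariant phi'E (conj Zq U'q) ts).
      by rewrite -mulf_div mulfV ?mul1r// charT_neq0//; exact: torus_embS.
    apply: regular_atM.
      by apply: regular_at_sub (h'reg _ OU') => q [Zq []].
    apply: regular_atV => //; last exact: h0.
    by apply: regular_at_sub (hreg _ OU) => q [Zq []].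
  move=> _ [[p v] /= Zp ->]; rewrite fst_Lorbit /= => Up U'p.
  rewrite phiE// phi'E// mulmx_const1; congr const_mx.
  have [s ts ->] := point_ofP Zp.
  rewrite -(chart_equivariant phiE (conj Zp Up) ts).
  rewrite -(chart_equivariant phi'E (conj Zp U'p) ts).
  have := h0 _ (over_gact ts (conj Zp Up)); move: (h (gact _ _)) => z z0.
  field; exact: z0.
- by move=> g _ tg [[p v] /= Zp ->]; rewrite Lact_Lorbit;
    exists (Lact lam g (p, v)) => //; exact: Zss_gact.
- move=> g _ tg [[p v] /= Zp ->].
  by rewrite Lact_Lorbit !fst_Lorbit Xact_orbitS.
- by move=> _ [[p v] /= Zp ->]; rewrite Lact_Lorbit Lact1.
- by move=> g g' _ tg tg' [[p v] /= Zp ->]; rewrite !Lact_Lorbit LactM.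
- by move=> s _ ts [[p v] /= Zp ->]; rewrite Lact_Lorbit Lorbit_Lact.
- move=> _ _ [U [phi [h [-> oU hreg h0 phiE]]]] [U' [phi' [h' [-> oU' h'reg h'0 phi'E]]]] /=.
  exists (fun g x => const_mx (charT lam g * h' (gact g (point_of x)) / h (point_of x))).
    move=> i j w Ww; have [tw Zw [Uw U'w]] := Ww.
    apply: (@regular_at_ext _ _ _ _ _ (fun w => charT lam (lsubmx w) *
        h' (gact (lsubmx w) (rsubmx w)) * (h (rsubmx w))^-1)).
      move=> {Ww tw Zw Uw U'w}w [/= tw Zw [Uw U'w]].
      have Zgw := Zss_gact tw Zw.
      rewrite mxE; have [s ts ->] := point_ofP Zw; rewrite -gactM torus_mulC gactM.
      rewrite -(chart_equivariant phiE (conj Zw Uw) ts).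
      rewrite Xact_orbitS in U'w.
      rewrite -(chart_equivariant phi'E (conj Zgw U'w) ts).
      have := charT_neq0 lam (torus_embS b ts); move: (charT lam (embS b s)) => x x0.
      have := h0 _ (over_gact ts (conj Zw Uw)); move: (h (gact _ _)) => z z0.
      by field; rewrite x0 z0.
    apply: regular_atM; first apply: regular_atM.
    - exact: regular_charT.
    - apply: (regular_at_comp (u := fun w => gact (lsubmx w) (rsubmx w))
        (W' := over U') Ww) => [v [/= tv Zv [_]]||].
      + by rewrite Xact_orbitS => U'v; split => //; exact: Zss_gact.
      + by move=> k; apply: regular_gact.
      + by apply: h'reg; split; [exact: Zss_gact|rewrite -Xact_orbitS].
    - apply: regular_atV => //; last exact: h0.
      apply: (regular_at_comp (u := fun w => rsubmx w) (W' := over U) Ww)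
        => [v [/= tv Zv []//]|k|]; last exact: hreg.
      exact: regular_at_rsubmx.
  move=> g _ tg [[p v] /= Zp ->]; rewrite Lact_Lorbit fst_Lorbit Xact_orbitS /= => Up U'gp.
  have Zgp := Zss_gact tg Zp.
  rewrite phiE// phi'E// mulmx_const1; congr const_mx.
  have [s ts ->] := point_ofP Zp.
  rewrite -gactM torus_mulC gactM.
  rewrite -(chart_equivariant phiE (conj Zp Up) ts).
  rewrite -(chart_equivariant phi'E (conj Zgp U'gp) ts).
  have := h0 _ (over_gact ts (conj Zp Up)); move: (h (gact _ _)) => z z0 /=.
  field; exact: z0.
Qed.
End LineBundle.

(** * The rank of a class in K-theory *)

Section Rank.
Variables (R : realType) (n r : nat) (b : 'M[int]_(r, n)) (eta : 'cV[int]_r).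
Local Notation C := R[i].
Local Notation vbundle := (vbundle R b eta).
Local Notation free_vb := (free_vb R b eta).
Variable x0 : set 'rV[C]_(n + n).
Hypothesis Xx0 : X b eta x0.

(** On the fibres over x0, read in charts, the two maps become a row-free and a
    row-full matrix, and the kernel of the second is the row space of the
    first. *)
Lemma short_exact_rank (E1 E2 E3 : bundle_data R n) (c1 c2 c3 : chart R n) :
  is_vbundle b eta E1 -> is_vbundle b eta E2 -> is_vbundle b eta E3 ->
  short_exact b eta E1 E2 E3 ->
  bdl_atlas E1 c1 -> bdl_atlas E2 c2 -> bdl_atlas E3 c3 ->
  chart_dom c1 x0 -> chart_dom c2 x0 -> chart_dom c3 x0 ->
  chart_rk c2 = (chart_rk c1 + chart_rk c3)%N.
Proof.
move=> vb1 vb2 vb3 [f [g [[morf morg] f_inj g_surj fg]]] a1 a2 a3 d1 d2 d3.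
have [M12 _ M12E] := mor_regular morf a1 a2.
have [M23 _ M23E] := mor_regular morg a2 a3.
(* The fibre over x0 is identified with row vectors by the charts, so that
   injectivity, surjectivity and exactness can be tested on coordinates. *)
have free12 : row_free (M12 x0).
  apply: inj_row_free => v vM.
  have [e [[te pe ce] _]] := vb_triv vb1 a1 d1 v.
  have [e0 [[te0 pe0 ce0] _]] := vb_triv vb1 a1 d1 0.
  have fE e' : bdl_tot E1 e' -> bdl_proj E1 e' = x0 ->
      chart_map c2 (f e') = chart_map c1 e' *m M12 x0.
    by move=> te' pe'; rewrite -[in RHS]pe'; apply: M12E; rewrite ?pe'.
  have [e2 [_ e2U]] := vb_triv vb2 a2 d2 0.
  suff ee0 : e = e0 by rewrite -ce ee0 ce0.
  apply: f_inj => //; rewrite -[RHS]e2U -?[LHS]e2U//; split.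
  - exact: mor_tot morf _ te.
  - by rewrite (mor_proj morf).
  - by rewrite fE// ce vM.
  - exact: mor_tot morf _ te0.
  - by rewrite (mor_proj morf).
  - by rewrite fE// ce0 mul0mx.
have full23 : row_full (M23 x0).
  apply/row_fullP; suff /choice[u uE] : forall i, exists u, u *m M23 x0 = row i 1%:M.
    exists (\matrix_i u i); apply/row_matrixP => i.
    by rewrite row_mul rowK uE.
  move=> i; have [e [[te pe ce] _]] := vb_triv vb3 a3 d3 (row i 1%:M).
  have [e' te' ge'] := g_surj e te.
  have pe' : bdl_proj E2 e' = x0 by rewrite -(mor_proj morg te') ge'.
  by exists (chart_map c2 e'); rewrite -ce -ge' -pe'; apply/esym/M23E; rewrite ?pe'.
have ker23 (v : 'rV_(chart_rk c2)) : v *m M23 x0 = 0 <-> exists u, v = u *m M12 x0.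
  have [e [[te pe ce] eU]] := vb_triv vb2 a2 d2 v.
  have gE : chart_map c3 (g e) = v *m M23 x0.
    by rewrite -ce -pe; apply: M23E; rewrite ?pe.
  have gp : bdl_proj E3 (g e) = x0 by rewrite (mor_proj morg).
  split=> [vM|[u uE]].
    have [e' te' fe'] : exists2 e', bdl_tot E1 e' & f e' = e.
      by apply/(fg e te); exists c3; split; rewrite ?gp// gE.
    have pe' : bdl_proj E1 e' = x0 by rewrite -(mor_proj morf te') fe'.
    by exists (chart_map c1 e'); rewrite -ce -fe' -pe'; apply: M12E; rewrite ?pe'.
  have [e' [[te' pe' ce'] _]] := vb_triv vb1 a1 d1 u.
  have fe' : f e' = e.
    apply/esym/eU; split; [exact: mor_tot morf _ te'|by rewrite (mor_proj morf)|].
    by rewrite uE -ce' -pe'; apply: M12E; rewrite ?pe'.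
  have [c [ac dc c0]] : fibre_zero E3 (g e) by apply/(fg e te); exists e'.
  have [N _ NE] := vb_transition vb3 ac a3.
  rewrite -gE NE ?c0 ?mul0mx//; first exact: mor_tot morg _ te.
  by rewrite gp.
have rk_ker : \rank (kermx (M23 x0)) = chart_rk c1.
  move: free12; rewrite /row_free => /eqP <-; apply/eqmx_rank/andP; split.
    apply/row_subP => i; have /ker23[u ->] : row i (kermx (M23 x0)) *m M23 x0 = 0.
      by rewrite -row_mul mulmx_ker row0.
    exact: submxMl.
  apply/row_subP => i; apply/sub_kermxP/ker23; exists (row i 1%:M).
  by rewrite -row_mul mul1mx.
move: rk_ker full23; rewrite mxrank_ker /row_full => rk /eqP rk3.
by have := rank_leq_row (M23 x0); move: rk; rewrite rk3; lia.
Qed.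

(** Read in a chosen chart at x0; [short_exact_rank] holds for every choice. *)
Definition fibre_rank (E : vbundle) : nat :=
  chart_rk (s2val (cid2 (vb_cover (svalP E) Xx0))).

Definition rank_map (z : free_vb) : int :=
  fglift (fun E => (fibre_rank E)%:Z : int^o) z.

Lemma rank_mapB (y z : free_vb) : rank_map (y - z) = rank_map y - rank_map z.
Proof. exact: (@lift_is_additive _ _ int^o). Qed.

HB.instance Definition _ := GRing.isZmodMorphism.Build free_vb int rank_map rank_mapB.

Lemma rank_map_gen E : rank_map (gen_vb E) = (fibre_rank E)%:Z.
Proof. by rewrite /rank_map /gen_vb liftU scale1r. Qed.

Lemma rank_map_relations z : z \in @relations R n r b eta -> rank_map z = 0.
Proof.
rewrite unfold_in => /asboolP relz.
apply: (relz (fun z => rank_map z = 0)) => [|x y x0' y0|_ [E1 [E2 [E3 [ex ->]]]]].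
- exact: raddf0.
- by rewrite rank_mapB x0' y0 subrr.
rewrite !rank_mapB !rank_map_gen /fibre_rank.
case: (cid2 _) => c1 /= a1 d1; case: (cid2 _) => c2 /= a2 d2; case: (cid2 _) => c3 /= a3 d3.
rewrite (short_exact_rank (svalP E1) (svalP E2) (svalP E3) ex a2 a1 a3)//.
by rewrite PoszD; ring.
Qed.

(** The rank at x0 vanishes on the relations and is k times a positive number on
    k times the generator of E. *)
Lemma Kclass_neq0 (E : bundle_data R n) : is_vbundle b eta E ->
  (forall c, bdl_atlas E c -> chart_dom c x0 -> chart_rk c <> 0%N) ->
  forall k : int, k != 0 -> Kclass b eta E *~ k <> 0.
Proof.
move=> vbE rkE k k0; rewrite /Kclass; case: pselect => // vbE'.
set G := gen_vb _ => Gk0.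
have : G *~ k \in @relations R n r b eta.
  rewrite -[G *~ k]subr0 Quotient.idealrBE raddf0; apply/eqP.
  by rewrite raddfMz.
move=> /rank_map_relations/eqP.
rewrite raddfMz /= rank_map_gen -mulrzl mulf_eq0 intz (negPf k0) /= /fibre_rank.
case: (cid2 _) => c /= ac dc; rewrite eqz_nat => /eqP; exact: rkE.
Qed.
End Rank.

(** * Leading terms *)

(** Write eta as the integral combination of the b_i with coefficients c, and
    put x_i = 1 where c_i > 0, y_i = 1 where c_i < 0, all other coordinates
    being 0. The monomial with exponents |c_i| has weight - eta. *)
Lemma Zss_nonempty (R : realType) (n r d : nat) (a : 'M[int]_(d, n))
    (b : 'M[int]_(r, n)) (eta : 'cV[int]_r) :
  toric_hyperkahler_data a b eta -> exists p : 'rV[R[i]]_(n + n), Zss b eta p.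
Proof.
move=> hX; have [c bc] := thk_b_surj hX eta.
exists (row_mx (\row_i (0 < c i 0)%R%:R) (\row_i (c i 0 < 0)%R%:R)); split.
  rewrite /moment_map big1// => i _; rewrite row_mxKl row_mxKr !mxE.
  by case: (ltgtP (c i 0) 0) => _; rewrite ?mulr0 ?mul0r scale0r.
apply/semistableP.
pose mm : multinom (n + n) := Multinom [tuple (match fintype.split k with
  | inl i => if 0 < c i 0 then absz (c i 0) else 0%N
  | inr i => if c i 0 < 0 then absz (c i 0) else 0%N end) | k < (n + n)].
have mml i : mm (lshift n i) = if 0 < c i 0 then absz (c i 0) else 0%N.
  by rewrite mnmE (unsplitK (inl i)).
have mmr i : mm (rshift n i) = if c i 0 < 0 then absz (c i 0) else 0%N.
  by rewrite mnmE (unsplitK (inr i)).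
exists 1%N, mm; split => //.
  rewrite mulr1n -bc /monomial_weight; apply/colP => k.
  rewrite summxE !mxE -sumrN; apply: eq_bigr => i _.
  rewrite mml mmr !mxE mulrC -mulrN; congr (_ * _).
  case: (ltgtP (c i 0) 0) => ci; last by rewrite ci.
    by rewrite ltz0_abs// subr0.
  by rewrite gtz0_abs// sub0r.
move=> k; case: (split_ordP k) => i ->; rewrite ?mml ?mmr ?row_mxEl ?row_mxEr mxE.
  by case: ifP; rewrite ?oner_neq0.
by case: ifP; rewrite ?oner_neq0.
Qed.

Lemma qpochhammer_inv_coef0 r : qpochhammer_inv_coef r 0 = 1.
Proof. by rewrite /qpochhammer_inv_coef big_ord1 expr0 coef1. Qed.

Lemma signz_neq0 (k : int) : (-1 : int) ^ k != 0.
Proof.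
by case: k => k; rewrite ?NegzE -?exprz_inv ?invrN1 signr_eq0.
Qed.

Section Main.
Variables (R : realType) (n r d : nat).
Variables (a : 'M[int]_(d, n)) (b : 'M[int]_(r, n)) (eta : 'cV[int]_r).
Hypothesis hX : toric_hyperkahler_data a b eta.
Variables (iota : 'M[int]_(n, r)).
Hypothesis hiota : b *m iota = 1%:M.
Variables (s : 'cV[R]_r) (lam : 'cV[int]_n).

Lemma cube_height u (x : 'cV[R]_d) i :
  (`|displacement b iota s lam u i 0 + dot x (intcV R (col i a))| < 1 / 2) =
  (((lam + inclS b u) i 0)%:~R < Defs.height a iota s x i < ((lam + inclS b u) i 0 + 1)%:~R).
Proof.
rewrite ltr_norml /Defs.height -/(offset iota s) [displacement _ _ _ _ _ _ _]mxE rmorphD /=.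
set v := (_%:~R : R); set h := dot _ _; set c := offset _ _ _ _.
by apply/andP/andP => -[]; split; lra.
Qed.

(** An interior point of A shows that iota(s) + h^* meets the open cube at
    mu_A. *)
Lemma alcove_strict_min A beta : Alc a iota s A -> lam = mu a iota s A + inclS b beta ->
  forall u, u != - beta -> theta_exponent b s lam (- beta) < theta_exponent b s lam u.
Proof.
move=> /alcove_interior[x _ xP] lamE.
apply: (theta_exponent_strict_min hiota (thk_exact hX) (x := x)) => i.
by rewrite cube_height inclSN lamE addrK.
Qed.

Lemma Lclass_neq0 (nu : 'cV[int]_n) (k : int) : k != 0 -> Lclass R b eta nu *~ k <> 0.
Proof.
have [p0 Zp0] := Zss_nonempty R hX.
have Xp0 : X b eta (orbitS b p0) by exists p0.
apply: (Kclass_neq0 Xp0); first exact: Lbundle_is_vbundle hX nu.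
by move=> _ [U [phi [h [->]]]].
Qed.

(** At the minimal exponent only the pair (0, u0) contributes, and the constant
    term of the inverse of (q; q)_oo^r is 1. *)
Lemma theta_leading_term u0 :
  (forall u, u != u0 -> theta_exponent b s lam u0 < theta_exponent b s lam u) ->
  has_leading_term (theta_coef b eta s lam)
    (Lclass R b eta (lam + inclS b u0) *~ (-1) ^ dot kappa (inclS b u0)).
Proof.
move=> min_u0; exists (theta_exponent b s lam u0).
have coefE : theta_coef b eta s lam (theta_exponent b s lam u0) =
    Lclass R b eta (lam + inclS b u0) *~ (-1) ^ dot kappa (inclS b u0).
  rewrite /theta_coef (_ : [set ku | _] = [set (0%N, u0)]).
    by rewrite fsbig_set1 /= qpochhammer_inv_coef0 mul1r.
  apply/seteqP; split => [[k u]|_ ->] /=; last by rewrite add0r.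
  have [->|/min_u0] := eqVneq u u0; last first.
    by move=> lt_u tE; exfalso; have := ler0n R k; lra.
  by move/eqP; rewrite -[X in _ == X]add0r (inj_eq (addIr _)) pnatr_eq0 => /eqP->.
split => // [|t t_lt].
  by rewrite coefE; apply: Lclass_neq0; exact: signz_neq0.
rewrite /theta_coef (_ : [set ku | _] = set0) ?fsbig_set0//.
apply/seteqP; split => // -[k u] /=.
by have [->|/min_u0 lt_u] := eqVneq u u0 => tE; have := ler0n R k; lra.
Qed.
End Main.

Theorem proposition6p13 (R : realType) (n r d : nat)
    (a : 'M[int]_(d, n)) (b : 'M[int]_(r, n)) (eta : 'cV[int]_r)
    (hX : toric_hyperkahler_data a b eta)
    (iota : 'M[int]_(n, r)) (hiota : b *m iota = 1%:M)
    (s : 'cV[R]_r) (hs : s_regular a b s) (lam : 'cV[int]_n) :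
  (exists! Abeta : set 'cV[R]_d * 'cV[int]_r,
     Alc a iota s Abeta.1 /\ lam = mu a iota s Abeta.1 + inclS b Abeta.2) /\
  (forall (A : set 'cV[R]_d) (beta : 'cV[int]_r),
     Alc a iota s A -> lam = mu a iota s A + inclS b beta ->
     has_leading_term (theta_coef b eta s lam)
       (Lclass R b eta (mu a iota s A) *~ ((-1) ^ dot kappa (inclS b beta)))).
Proof.
split; last first.
  move=> A beta AA lamE.
  have := theta_leading_term hX (alcove_strict_min hX hiota AA lamE).
  rewrite inclSN {2}lamE addrK.
  have -> : dot kappa (- inclS b beta) = - dot kappa (inclS b beta).
    by rewrite /dot mulmxN mxE.
  by rewrite -exprz_inv invrN1.
have [u0 u0min] := theta_exponent_min hiota s lam.
have [x xP] := theta_min_cube hiota (thk_exact hX) (thk_a_surj hX) (thk_unimodular hX) hs u0min.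
have [A AA muA] : exists2 A, Alc a iota s A & mu a iota s A = lam + inclS b u0.
  by apply: (@alcove_of_interior _ _ _ _ _ _ _ _ x) => i; rewrite -cube_height.
have lamA : lam = mu a iota s A + inclS b (- u0) by rewrite muA inclSN addrK.
exists (A, - u0); split => // -[A' beta'] /= [AA' lamA'].
have beta_eq : beta' = - u0.
  apply: contrapT => /eqP ne.
  have := alcove_strict_min hX hiota AA lamA (u := - beta').
  have := alcove_strict_min hX hiota AA' lamA' (u := - - u0).
  rewrite !eqr_opp eq_sym ne => /(_ isT) lt1 /(_ isT) lt2.
  by have := lt_trans lt1 lt2; rewrite ltxx.
rewrite beta_eq in lamA' *; congr pair.
by apply: mu_inj AA AA' _; apply: (addIr (inclS b (- u0))); rewrite -lamA -lamA'.
Qed.
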